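(* Let $N\ge2$ be an integer, let $m_0,m_0'\in L^\infty(\mathbb{T})$ be non-singular, and let $\varphi,\varphi'\in L^2(\mathbb{R})$ be cyclic vectors for the wavelet representation of $\mathfrak{A}_N$ on $L^2(\mathbb{R})$ with $U\varphi=\pi(m_0)\varphi$ and $U\varphi'=\pi(m_0')\varphi'$. Let $h=\operatorname{Per}(|\widehat\varphi|^2)$ and $h'=\operatorname{Per}(|\widehat{\varphi'}|^2)$. Then each solution $h_0\in L^1(\mathbb{T})$ of $R_{m_0,m_0'}h_0=h_0$ with $|h_0|^2\le c\,h\,h'$ for some positive constant $c$ has the form $$h_0=\operatorname{Per}\left(f\,\overline{\widehat\varphi}\,\widehat{\varphi'}\right)$$ for some $f\in L^\infty(\mathbb{R})$ with $f(Nx)=f(x)$ a.e. on $\mathbb{R}$. Conversely, for any $f\in L^\infty(\mathbb{R})$ with $f(Nx)=f(x)$ a.e., the function $h_0=\operatorname{Per}(f\,\overline{\widehat\varphi}\,\widehat{\varphi'})$ is an $L^1(\mathbb{T})$-solution of $R_{m_0,m_0'}h_0=h_0$ and satisfies $|h_0|^2\le c\,h\,h'$ for some $c>0$.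
   Context: $\mathbb{T}$ is the unit circle with normalized Haar measure; functions on $\mathbb{T}$ are identified with $2\pi$-periodic functions on $\mathbb{R}$ via $z=e^{-i\omega}$. A function $m\in L^\infty(\mathbb{T})$ is non-singular if it does not vanish on a subset of $\mathbb{T}$ of positive measure. The Fourier transform is $\widehat\psi(x)=\int_{\mathbb{R}}\psi(t)e^{-itx}\,dt$ (extended to $L^2(\mathbb{R})$). For $g\in L^1(\mathbb{R})$, $\operatorname{Per}(g)(\omega)=\sum_{k\in\mathbb{Z}}g(\omega+2k\pi)$. Ruelle transfer operator on $L^1(\mathbb{T})$: $R_{m_0,m_0'}f(z)=\frac1N\sum_{w^N=z}\overline{m_0(w)}\,m_0'(w)f(w)$. $\mathfrak{A}_N$ is the $C^*$-algebra generated by two unitaries $U,V$ with $UVU^{-1}=V^N$. Its wavelet representation on $L^2(\mathbb{R})$ is given by $U\psi(x)=\frac1{\sqrt N}\psi\left(\frac xN\right)$ and $V\psi(x)=\psi(x-1)$; $V=\pi(z)$, where $\pi$ is the representation of $L^\infty(\mathbb{T})$ on $L^2(\mathbb{R})$ given by $\widehat{\pi(f)\psi}=f\widehat\psi$ ($f$ viewed as a $2\pi$-periodic function). A vector $\varphi$ is cyclic if $\{U^{-n}\pi(f)\varphi: n\in\mathbb{N}, f\in L^\infty(\mathbb{T})\}$ is dense in $L^2(\mathbb{R})$. *)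

(* Defs.v *)
From HB Require Import structures.
From mathcomp Require Import all_boot all_order all_algebra.
From mathcomp Require Import complex.
From mathcomp Require Import all_classical all_reals all_analysis.
From mathcomp.analysis.showcase Require summability.
Import Order.TTheory GRing.Theory Num.Theory.
Import numFieldNormedType.Exports.

Set Implicit Arguments.
Unset Strict Implicit.
Unset Printing Implicit Defensive.

Local Open Scope classical_set_scope.
Local Open Scope ring_scope.

Notation normc := ComplexField.Normc.normc.

(* Elements of L^p spaces are represented by Borel measurable functions defined
   everywhere; identities between such elements are stated almost everywhere. *)
Section spaces.
Context {R : realType}.
Local Notation mu := (@lebesgue_measure R).
Implicit Types (f : R -> R[i]) (p : \bar R).

Definition cmeasurable f :=
  measurable_fun [set: R] (fun x => complex.Re (f x)) /\
  measurable_fun [set: R] (fun x => complex.Im (f x)).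

Definition LnormC p f : \bar R := Lnorm mu p (fun x => (normc (f x))%:E).

Definition LpR p f := cmeasurable f /\ (LnormC p f < +oo)%E.

(* Functions on the circle are 2 pi-periodic functions on the line, through
   z = exp(- i w). The interval [0, 2 pi[ is a fundamental domain, on which
   normalized Haar measure is Lebesgue measure divided by 2 pi: null sets and
   integrability are those of Lebesgue measure. *)
Definition periodic2pi f := forall w : R, f (w + 2 * pi) = f w.

Definition circle_dom : set R := `[0, 2 * pi[%classic.

Definition L1T f :=
  [/\ periodic2pi f, cmeasurable f &
      mu.-integrable circle_dom (fun w => (normc (f w))%:E)].

Definition LinftyT f := periodic2pi f /\ LpR +oo%E f.

Definition nonsingular f := forall A : set R,
  measurable A -> A `<=` circle_dom -> (forall w, A w -> f w = 0) -> mu A = 0%E.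

End spaces.

Section fourier.
Context {R : realType}.
Local Notation mu := (@lebesgue_measure R).
Implicit Types (psi eta g f : R -> R[i]).

Definition cintegral g : R[i] :=
  Complex (\int[mu]_t complex.Re (g t)) (\int[mu]_t complex.Im (g t)).

Definition expNi (y : R) : R[i] := Complex (cos y) (- sin y).

Definition fourierL1 psi (x : R) : R[i] :=
  cintegral (fun t => psi t * expNi (t * x)).

(* The extension to L^2 of the transform on L^1 /\ L^2, given by its graph:
   g is a representative of the Fourier transform of psi. *)
Definition is_fourier psi g :=
  [/\ LpR 2%:E psi, LpR 2%:E g &
      exists u : nat -> R -> R[i],
        [/\ forall n, LpR 1%:E (u n) /\ LpR 2%:E (u n),
            (fun n => LnormC 2%:E (u n \- psi)) @ \oo --> 0%E &
            (fun n => LnormC 2%:E (fourierL1 (u n) \- g)) @ \oo --> 0%E]].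

(* eta = pi(f) psi in L^2 *)
Definition is_pi f psi eta :=
  exists2 g, is_fourier psi g & is_fourier eta (fun x => f x * g x).

Definition dilation (N : nat) psi (x : R) : R[i] :=
  real_complex R (Num.sqrt N%:R)^-1 * psi (x / N%:R).

Definition dilationV (N : nat) psi (x : R) : R[i] :=
  real_complex R (Num.sqrt N%:R) * psi (N%:R * x).

Lemma dilationK N : (0 < N)%N -> cancel (dilation N) (dilationV N).
Proof.
move=> N0 psi; apply/funext => x; rewrite /dilationV /dilation.
have NR0 : (N%:R : R) != 0 by rewrite pnatr_eq0 -lt0n.
rewrite mulrA -rmorphM divff ?mul1r; first by rewrite mulrAC divff ?mul1r.
by rewrite gt_eqF// sqrtr_gt0 ltr0n.
Qed.

Lemma dilationVK N : (0 < N)%N -> cancel (dilationV N) (dilation N).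
Proof.
move=> N0 psi; apply/funext => x; rewrite /dilationV /dilation.
have NR0 : (N%:R : R) != 0 by rewrite pnatr_eq0 -lt0n.
rewrite mulrA -rmorphM mulVf ?mul1r; first by rewrite mulrCA divff ?mulr1.
by rewrite gt_eqF// sqrtr_gt0 ltr0n.
Qed.

Definition cyclic_vector (N : nat) (phi : R -> R[i]) :=
  LpR 2%:E phi /\
  forall psi, LpR 2%:E psi -> forall e : R, 0 < e ->
    exists n : nat, exists f : R -> R[i], exists eta : R -> R[i],
      [/\ LinftyT f, is_pi f phi eta &
          (LnormC 2%:E (psi \- iter n (dilationV N) eta)%R < e%:E)%E].

End fourier.

(* summability.sum is the unconditional sum over the index type int, defined as
   a limit; for real or complex g it is 0 where the family is not summable, so
   that Per g is everywhere 2 pi-periodic. *)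
Definition Per (R : realType) (K : numDomainType) (V : normedModType K)
    (g : R -> V) (w : R) : V :=
  summability.sum (fun k : int => g (w + 2 * k%:~R * pi)).

(* With z = exp(- i w), the N-th roots of z are the exp(- i v) for
   v = (w + 2 k pi) / N and 0 <= k < N. *)
Definition ruelle (R : realType) (N : nat) (m m' f : R -> R[i]) (w : R) : R[i] :=
  N%:R^-1 * \sum_(k < N)
    (let v := (w + 2 * k%:R * pi) / N%:R in conjc (m v) * m' v * f v).

(* Main.v *)
Require Import Defs.
From HB Require Import structures.
From mathcomp Require Import all_boot all_order all_algebra finmap.
From mathcomp Require Import complex.
From mathcomp Require Import all_classical all_reals all_analysis.
From mathcomp Require Import measurable_realfun ess_sup_inf.
From mathcomp Require Import ring lra zify.
From mathcomp.analysis.showcase Require summability.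
Import Order.TTheory GRing.Theory Num.Theory.
Import numFieldNormedType.Exports.

(** Write [p] and [p'] for the two Fourier transforms and
[q = N^-1 * conj m0 * m0'].

The hypothesis on [phi] says that [sqrt N * p (N x) = m0 x * p x] almost
everywhere, and likewise for [phi']. To get this from the definition of the
Fourier transform on L^2 as a limit, the transform is paired with indicators of
intervals [is_fourier_itv]: the transform of such an indicator is square
integrable, so that the pairing passes to L^2 limits, and a function is
determined by its integrals over intervals [fourier_dilation]. It follows that
the product [conj p * p'] is multiplied by [q] under the dilation by [N]
[conj_product_dilated].

Let [f] be bounded with [f (N x) = f x]. The function [F = f * conj p * p'] then
satisfies [F (N x) = q x * F x]. Splitting the translates of [w] by the
multiples of [2 pi] into [N] classes gives the Ruelle equation for the
periodization of [F] [ruelle_cPer_symbol], and the Cauchy-Schwarz inequality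
gives the bound [cPer_symbol_bound].

Let conversely [h0] be a solution. If [h0] is the periodization of some [F] with
[F (N x) = q x * F x], then the sum of [F] over the translates of [x] by the
multiples of [2 pi N^n] must be
[G n x = q (x / N) * ... * q (x / N^n) * h0 (x / N^n)], the [cascade] of [h0].
Only the term [F x] of that sum survives as [n] grows, so [F] has to be the
limit of [G n]. To see that this limit exists and has the right sum, fix [x] and
look at the translates of [x] by the multiples of [2 pi]. The Ruelle equation
says that [G n] at [x] is the sum of [G n.+1] over [N] translates
[cascade_refine], and the bound on [h0] says that [|G n|^2] is at most [c] times
the product of the analogous sums for [|p|^2] and [|p'|^2] [cascade_bound].
Hence [|G n|] is at most the sum, over a class modulo [N^n], of a fixed summable
family on the integers. That majorant is refined by the very same rule, which
controls both the increments of [G n] and the error in the sum over a full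
window of residues [tower_sum]. This yields pointwise convergence almost
everywhere, the identity that [h0] is the periodization of [F], and the bound
[|F|^2 <= c * |p|^2 * |p'|^2] [cascade_limitP]. The quotient of [F] by
[conj p * p'] is therefore bounded, and it is invariant because numerator and
denominator are both multiplied by [q], which is nonzero almost everywhere
[quotient_symbol_invariant]. *)

Local Open Scope classical_set_scope.
Local Open Scope ring_scope.

Set Implicit Arguments.
Unset Strict Implicit.
Unset Printing Implicit Defensive.

#[local] Existing Instance summability.totally_filter.
Local Notation totally := summability.totally.
Local Notation partial_sum := summability.partial_sum.

(** * Unconditional sums of real families *)

(** An inductive wrapper, so that views and [apply] do not unfold it to the
quantifiers of filter convergence. *)
Variant has_sum {R : realType} {I : choiceType} (x : I -> R) (l : R) : Prop :=
  HasSum of partial_sum x @ totally --> l.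

Section has_sum_theory.
Context {R : realType}.
Implicit Types (I J : choiceType) (l s t M : R).

Lemma partial_sumE {V : zmodType} {I : choiceType} (x : I -> V) (A : {fset I}) :
  partial_sum x A = \sum_(i <- A) x i.
Proof. by rewrite /partial_sum big_seq_fsetE. Qed.

Lemma has_sumP {I : choiceType} (x : I -> R) l :
  has_sum x l <-> forall e : R, 0 < e -> exists A : {fset I},
    forall B : {fset I}, (A `<=` B)%fset -> `|l - \sum_(i <- B) x i| < e.
Proof.
split => [[/cvgrPdist_lt xl] e e0|xl].
  have [A _ AP] := xl e e0; exists A => B AB.
  by rewrite -partial_sumE; exact: AP.
apply: HasSum; apply/cvgrPdist_lt => e e0; have [A AP] := xl e e0.
by exists A => // B /= AB; rewrite partial_sumE; exact: AP.
Qed.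

Lemma has_sum_unique {I : choiceType} (x : I -> R) l l' :
  has_sum x l -> has_sum x l' -> l = l'.
Proof. by case=> xl [xl']; exact: (cvg_unique (@norm_hausdorff _ R) xl xl'). Qed.

Lemma has_sum_sum {I : choiceType} (x : I -> R) l :
  has_sum x l -> summability.sum (x : I -> R^o) = l.
Proof. by case=> xl; apply: cvg_lim => //; exact: norm_hausdorff. Qed.

Lemma has_sumD {I : choiceType} (x y : I -> R) l l' :
  has_sum x l -> has_sum y l' -> has_sum (fun i => x i + y i) (l + l').
Proof.
case=> xl [yl]; apply: HasSum.
rewrite [X in X @ _](_ : _ = partial_sum x \+ partial_sum y).
  exact: cvgD.
by apply/funext => A /=; rewrite !partial_sumE big_split.
Qed.

Lemma has_sumZ {I : choiceType} (c : R) (x : I -> R) l :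
  has_sum x l -> has_sum (fun i => c * x i) (c * l).
Proof.
case=> xl; apply: HasSum.
rewrite [X in X @ _](_ : _ = fun A => c * partial_sum x A).
  by apply: cvgMr; exact: xl.
by apply/funext => A /=; rewrite !partial_sumE big_distrr.
Qed.

Lemma has_sumB {I : choiceType} (x y : I -> R) l l' :
  has_sum x l -> has_sum y l' -> has_sum (fun i => x i - y i) (l - l').
Proof.
move=> xl yl; have := has_sumD xl (has_sumZ (-1) yl).
by rewrite mulN1r; congr has_sum; apply/funext => i; rewrite mulN1r.
Qed.

Lemma has_sum_bigsum {I : choiceType} (T : Type) (r : seq T) (x : T -> I -> R)
    (l : T -> R) :
  (forall j, has_sum (x j) (l j)) ->
  has_sum (fun i => \sum_(j <- r) x j i) (\sum_(j <- r) l j).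
Proof.
move=> xl; elim: r => [|j r IH].
  rewrite big_nil; apply/has_sumP => e e0; exists fset0 => B _.
  by rewrite big1 ?subrr ?normr0// => i _; rewrite big_nil.
rewrite big_cons; have := has_sumD (xl j) IH; congr has_sum.
by apply/funext => i; rewrite big_cons.
Qed.

(** Only the indices in the image of an injection contribute, so the two nets
of partial sums have the same limits. *)
Lemma has_sum_inj {I J : choiceType} (h : I -> J) (x : J -> R) l :
  injective h -> (forall j, ~ range h j -> x j = 0) ->
  has_sum x l <-> has_sum (x \o h) l.
Proof.
move=> hinj x0.
have sumE (A : {fset I}) : \sum_(i <- A) (x \o h) i = \sum_(j <- (h @` A)%fset) x j.
  by rewrite big_imfset//=; move=> ? ? _ _; exact: hinj.
split => /has_sumP xl; apply/has_sumP => e /xl[A AP].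
- have fA : finite_set (h @^-1` [set` A]).
    by apply: finite_preimage => // ? ? _ _; exact: hinj.
  exists (fset_set (h @^-1` [set` A])) => B /fsubsetP AB.
  rewrite sumE.
  have -> : \sum_(j <- (h @` B)%fset) x j = \sum_(j <- (A `|` (h @` B))%fset) x j.
    apply: big_fset_incl; first exact: fsubsetUr.
    move=> j /fsetUP[jA|->//] jB; apply: x0 => -[i _ hij].
    move/negP: jB; apply; apply/imfsetP; exists i => //=.
    by apply: AB; rewrite in_fset_set// inE/= hij.
  by apply: AP; exact: fsubsetUl.
- exists (h @` A)%fset => B /fsubsetP AB.
  have fB : finite_set (h @^-1` [set` B]).
    by apply: finite_preimage => // ? ? _ _; exact: hinj.
  have -> : \sum_(j <- B) x j = \sum_(i <- fset_set (h @^-1` [set` B])) (x \o h) i.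
    rewrite sumE; apply/esym/big_fset_incl.
      apply/fsubsetP => j /imfsetP[i /=].
      by rewrite in_fset_set// inE/= => ? ->.
    move=> j jB jn; apply: x0 => -[i _ hij].
    move/negP: jn; apply; apply/imfsetP; exists i => //=.
    by rewrite in_fset_set// inE/= hij.
  apply: AP; apply/fsubsetP => i iA; rewrite in_fset_set// inE/=.
  by apply: AB; apply/imfsetP; exists i.
Qed.

Lemma has_sum_nneg_exists {I : choiceType} (x : I -> R) M :
  (forall i, 0 <= x i) -> (forall A : {fset I}, \sum_(i <- A) x i <= M) ->
  exists l, has_sum x l.
Proof.
move=> x0 xM; pose S := [set \sum_(i <- A) x i | A in [set: {fset I}]].
have S_sup : has_sup S.
  split; first by exists (\sum_(i <- fset0) x i), fset0.
  by exists M => _ [A _ <-].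
exists (sup S); apply/has_sumP => e e0.
have [_ [A _ <-] Ae] := sup_adherent e0 S_sup.
exists A => B AB.
have AB_le : \sum_(i <- A) x i <= \sum_(i <- B) x i.
  rewrite (big_fsetID _ (mem A) B)/= (_ : [fset x in B | x \in A]%fset = A).
    by rewrite lerDl; apply: sumr_ge0.
  apply/fsetP => i; rewrite !inE/= andbC; apply: andb_idr => iA.
  by exact: (fsubsetP AB).
have B_le : \sum_(i <- B) x i <= sup S.
  by apply: sup_upper_bound => //; exists B.
rewrite ger0_norm ?subr_ge0// ltrBlDr -ltrBlDl.
exact: lt_le_trans Ae AB_le.
Qed.

Lemma has_sum_ge_partial {I : choiceType} (x : I -> R) l :
  (forall i, 0 <= x i) -> has_sum x l ->
  forall A : {fset I}, \sum_(i <- A) x i <= l.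
Proof.
move=> x0 /has_sumP xl A; apply/ler_addgt0Pr => e /xl[B BP].
have := BP (A `|` B)%fset (fsubsetUr _ _).
have : \sum_(i <- A) x i <= \sum_(i <- (A `|` B)%fset) x i.
  rewrite (big_fsetID _ (mem A) (A `|` B)%fset)/=.
  rewrite (_ : [fset x in (A `|` B)%fset | x \in A]%fset = A).
    by rewrite lerDl; apply: sumr_ge0.
  by apply/fsetP => i; rewrite !inE/=; case: (i \in A); rewrite //= andbF.
move=> AAB; rewrite ltr_norml => /andP[le _].
by rewrite ltrNl opprB ltrBlDr addrC in le; exact: le_trans AAB (ltW le).
Qed.

Lemma has_sum_ge0 {I : choiceType} (x : I -> R) l :
  (forall i, 0 <= x i) -> has_sum x l -> 0 <= l.
Proof.
by move=> x0 /(has_sum_ge_partial x0)/(_ fset0); rewrite big_seq_fset0.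
Qed.

Lemma has_sum_le_bound {I : choiceType} (x : I -> R) l M :
  has_sum x l -> (forall A : {fset I}, \sum_(i <- A) x i <= M) -> l <= M.
Proof.
move=> /has_sumP xl xM; apply/ler_addgt0Pr => e /xl[A /(_ A (fsubset_refl _))].
rewrite ltr_norml ltrBlDr => /andP[_ le].
by rewrite addrC; apply: (le_trans (ltW le)); rewrite lerD2l.
Qed.

(** The family [x] is the difference of the nonnegative summable families [s + x]
and [s]. *)
Lemma has_sum_dominated {I : choiceType} (x s : I -> R) t :
  (forall i, `|x i| <= s i) -> has_sum s t ->
  exists2 l, has_sum x l & `|l| <= t.
Proof.
move=> xs st.
have s0 i : 0 <= s i by exact: le_trans (xs i).
have [l1 xl1] : exists l, has_sum (fun i => s i + x i) l.
  apply: (@has_sum_nneg_exists _ _ (2 * t)).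
    by move=> i; have := xs i; rewrite ler_norml; lra.
  move=> A; apply: (@le_trans _ _ (2 * \sum_(i <- A) s i)).
    rewrite big_distrr/=; apply: ler_sum => i _.
    by have := xs i; rewrite ler_norml; lra.
  by rewrite ler_pM2l//; exact: has_sum_ge_partial.
have xl : has_sum x (l1 - t).
  have := has_sumB xl1 st; congr has_sum.
  by apply/funext => i; rewrite addrC addKr.
exists (l1 - t) => //.
rewrite ler_norml; apply/andP; split.
- rewrite -subr_ge0 opprK; apply: has_sum_ge0 (has_sumD xl st) => i.
  by have := xs i; rewrite ler_norml; lra.
- rewrite -subr_ge0; apply: has_sum_ge0 (has_sumB st xl) => i.
  by have := xs i; rewrite ler_norml; lra.
Qed.

(** Otherwise the terms of one sign could be added to a finite set beyond which
the partial sums are stable. *)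
Lemma has_sum_abs_bounded {I : choiceType} (x : I -> R) l :
  has_sum x l -> exists M, forall A : {fset I}, \sum_(i <- A) `|x i| <= M.
Proof.
move=> /has_sumP/(_ 1 ltr01)[A AP].
have stable (B : {fset I}) : (A `&` B = fset0)%fset -> `|\sum_(i <- B) x i| <= 2.
  move=> AB0.
  have := AP _ (fsubset_refl A); have := AP _ (fsubsetUl A B).
  rewrite (big_fsetID _ (mem A) (A `|` B)%fset)/=.
  rewrite (_ : [fset x in (A `|` B)%fset | x \in A]%fset = A); last first.
    by apply/fsetP => i; rewrite !inE/=; case: (i \in A); rewrite //= andbF.
  rewrite (_ : [fset x in (A `|` B)%fset | x \notin A]%fset = B); last first.
    apply/fsetP => i; have := congr1 (fun C : {fset I} => i \in C) AB0.
    by rewrite !inE/=; case: (i \in A); case: (i \in B).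
  by rewrite !ltr_norml ler_norml; lra.
exists (\sum_(i <- A) `|x i| + 4) => B.
rewrite (big_fsetID _ (mem A) B)/=; apply: lerD.
  rewrite (big_fsetID _ (mem B) A)/= (_ : [fset x in B | x \in A]%fset =
    [fset x in A | x \in B]%fset); last by apply/fsetP => i; rewrite !inE/= andbC.
  by rewrite lerDl; apply: sumr_ge0.
set C := [fset _ in B | _]%fset.
rewrite (big_fsetID _ (fun i => 0 <= x i) C)/=.
have sub_ok (D : {fset I}) : (D `<=` C)%fset -> `|\sum_(i <- D) x i| <= 2.
  move=> /fsubsetP DC; apply: stable; apply/fsetP => i; rewrite !inE/=.
  by apply/negP => /andP[iA /DC]; rewrite !inE/= iA andbF.
have := sub_ok [fset i in C | 0 <= x i]%fset; have := sub_ok [fset i in C | ~~ (0 <= x i)]%fset.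
rewrite !fset_sub => /(_ isT) + /(_ isT).
set s1 := \sum_(i <- [fset _ in C | ~~ _]%fset) x i => h1.
set s2 := \sum_(i <- _) x i => h2.
rewrite (_ : \sum_(i <- [fset i in C | 0 <= x i]%fset) `|x i| = s2); last first.
  by apply: eq_big_seq => i; rewrite !inE/= => /andP[_ /ger0_norm].
rewrite (_ : \sum_(i <- [fset i in C | ~~ (0 <= x i)]%fset) `|x i| = - s1); last first.
  rewrite /s1 -sumrN; apply: eq_big_seq => i; rewrite !inE/= -ltNge => /andP[_].
  exact: ltr0_norm.
by move: h1 h2; rewrite !ler_norml; lra.
Qed.

Lemma has_sum_cofinal {I : choiceType} (x : I -> R) l (W : nat -> {fset I}) :
  W n @[n --> \oo] --> totally ->
  has_sum x l -> \sum_(i <- W n) x i @[n --> \oo] --> l.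
Proof.
move=> Wt [xl]; have := cvg_comp _ _ Wt xl.
by apply: cvg_trans; apply: near_eq_cvg; near=> n; rewrite /= partial_sumE.
Unshelve. all: by end_near. Qed.

End has_sum_theory.

Definition window (a : int) (n : nat) : {fset int} :=
  seq_fset tt [seq a + i%:Z | i <- iota 0 n].

Lemma window_sum {V : zmodType} (x : int -> V) (a : int) (n : nat) :
  \sum_(k <- window a n) x k = \sum_(i < n) x (a + i%:Z).
Proof.
rewrite (perm_big [seq a + i%:Z | i <- iota 0 n])/=.
  by rewrite big_map -(subn0 n) -/(index_iota 0 n) big_mkord subn0.
apply: uniq_perm; first exact: sort_keys_uniq.
  by rewrite map_inj_uniq ?iota_uniq// => i j /addrI [].
by move=> k; rewrite sort_keysE.
Qed.

Lemma mem_window (a : int) (n : nat) (k : int) :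
  (k \in window a n) = (a <= k < a + n%:Z).
Proof.
rewrite seq_fsetE; apply/mapP/idP => [H|].
  case: H => i; rewrite mem_iota => ? ->; apply/andP; split; lia.
case/andP => ak kn; exists `|k - a|%N; last by lia.
by rewrite mem_iota; lia.
Qed.

Lemma window_cofinal (a : nat -> int) (n : nat -> nat) :
  (forall m : nat, \forall i \near \oo,
     a i <= - m%:Z /\ m%:Z < a i + (n i)%:Z) ->
  window (a i) (n i) @[i --> \oo] --> summability.totally.
Proof.
move=> an P [A _ AP]; pose m := \max_(k <- A) `|k|%N.
have Am k : k \in A -> (`|k| <= m)%N by move=> kA; exact: leq_bigmax_seq.
have : \forall i \near \oo, forall k, k \in A -> k \in window (a i) (n i).
  near=> i => k /Am km; rewrite mem_window.
  have [] : a i <= - m%:Z /\ m%:Z < a i + (n i)%:Z by near: i; exact: an.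
  by move=> *; apply/andP; split; lia.
by apply: filterS => i Ai; apply: AP => /=; exact/fsubsetP.
Unshelve. all: by end_near. Qed.

(** * Sums over the integers and towers of residue classes *)

Section integer_sums.
Context {R : realType}.
Implicit Types (x s : int -> R) (l t : R).

Lemma has_sum_shift (a : int) x l :
  has_sum x l -> has_sum (fun k => x (a + k)) l.
Proof.
have off j : ~ range (fun k => a + k) j -> x j = 0.
  by case; exists (j - a) => //; rewrite addrC subrK.
by move=> xl; have := (has_sum_inj l (@addrI _ a) off).1 xl.
Qed.

(** Translating the finite index sets carries one net of partial sums to the
other, whether or not they converge. *)
Lemma sum_shift {K : numDomainType} {V : normedModType K} (x : int -> V) (a : int) :
  summability.sum (fun k => x (k + a)) = summability.sum x.
Proof.
rewrite /summability.sum /lim_in /=; congr get.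
have sh (b : int) (y : int -> V) : summability.partial_sum (fun k => y (k + b)) @ summability.totally
    `=>` (summability.partial_sum y @ summability.totally).
  move=> P [A _ AP]; exists [fset (k - b)%R | k in A]%fset => // B /= AB.
  have <- : summability.partial_sum y [fset (k + b)%R | k in B]%fset =
     summability.partial_sum (fun k => y (k + b)) B.
    by rewrite !partial_sumE big_imfset//= => ? ? _ _ /addIr.
  apply: AP => /=; apply/fsubsetP => k kA; apply/imfsetP; exists (k - b) => /=.
    by apply: (fsubsetP AB); apply/imfsetP; exists k.
  by rewrite subrK.
apply/seteqP; split => l xl.
  apply: cvg_trans xl; have := sh (- a) (fun k => x (k + a)).
  by under eq_fun do rewrite subrK.
by apply: cvg_trans xl; exact: sh.
Qed.

(** The family is the sum of its restrictions to the [N] residue classes. *)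
Lemma has_sum_residues (N : nat) x (c : 'I_N -> R) :
  (0 < N)%N ->
  (forall j : 'I_N, has_sum (fun l : int => x (j%:Z + N%:Z * l)) (c j)) ->
  has_sum x (\sum_j c j).
Proof.
move=> N0 xc; pose xj (j : 'I_N) k := if (k %% N)%Z == j%:Z then x k else 0.
have : has_sum (fun k => \sum_j xj j k) (\sum_j c j).
  apply: has_sum_bigsum => j.
  apply/(has_sum_inj (h := fun l : int => j%:Z + N%:Z * l)).
  - by move=> a b /addrI/mulfI; apply; lia.
  - move=> k kj; rewrite /xj; case: eqP => // kN; exfalso; apply: kj.
    exists (k %/ N)%Z => //; rewrite {2}(divz_eq k N) kN; lia.
  - have := xc j; congr has_sum; apply/funext => l; rewrite /xj/= ifT//.
    by rewrite mulrC addrC modzMDl modz_small//; case: j => j /= jN; lia.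
congr has_sum; apply/funext => k.
have kN : (`|(k %% N)%Z| < N)%N by lia.
rewrite (bigD1 (Ordinal kN))//= /xj ifT; last by apply/eqP => /=; lia.
rewrite big1 ?addr0// => j jk; rewrite ifF//; apply/eqP => kj.
by move/eqP: jk; apply; apply: val_inj => /=; lia.
Qed.

Lemma has_sum_subfamily {I J : choiceType} (h : I -> J) (s : J -> R) t :
  injective h -> (forall j, 0 <= s j) -> has_sum s t ->
  has_sum (s \o h) (summability.sum (s \o h : I -> R^o)).
Proof.
move=> hinj s0 st; have [l sl] : exists l, has_sum (s \o h) l.
  apply: (@has_sum_nneg_exists _ _ _ t) => [i|A]; first exact: s0.
  apply: le_trans (has_sum_ge_partial s0 st (h @` A)%fset).
  by rewrite big_imfset//= => ? ? _ _; exact: hinj.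
by rewrite (has_sum_sum sl).
Qed.

Definition class_sum (N : nat) s (n : nat) (k : int) : R :=
  summability.sum (fun l : int => s (k + (N ^ n)%N%:Z * l) : R^o).

Section class_sums.
Variables (N : nat) (s : int -> R) (t : R).
Hypotheses (N2 : (2 <= N)%N) (s0 : forall k, 0 <= s k) (st : has_sum s t).

Lemma class_sumP n k :
  has_sum (fun l : int => s (k + (N ^ n)%N%:Z * l)) (class_sum N s n k).
Proof.
apply: (has_sum_subfamily (h := fun l : int => k + (N ^ n)%N%:Z * l) _ s0 st).
have : (0 < N ^ n)%N by rewrite expn_gt0; lia.
by move=> Nn0 a b /addrI; nia.
Qed.

Lemma class_sum0 k : class_sum N s 0 k = t.
Proof.
apply: has_sum_unique (class_sumP 0 k) _.
have := has_sum_shift k st; congr has_sum.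
by apply/funext => l; rewrite expn0 mul1r.
Qed.

Lemma class_sumS n k :
  class_sum N s n k = \sum_(j < N) class_sum N s n.+1 (k + (N ^ n)%N%:Z * j%:Z).
Proof.
apply: has_sum_unique (class_sumP n k) _.
apply: has_sum_residues => [|j]; first by lia.
have := class_sumP n.+1 (k + (N ^ n)%N%:Z * j%:Z); congr has_sum.
by apply/funext => l; congr s; rewrite expnS; lia.
Qed.

(** A class modulo a large power of [N] meets a given finite set of indices in at
most one point, so that only the tail of the sum is left beside [s k]. *)
Lemma class_sum_cvg k : class_sum N s n k @[n --> \oo] --> s k.
Proof.
apply/cvgrPdist_le => e e0.
have [A AP] := (has_sumP s t).1 st e e0.
pose m := (\max_(i <- A) `|i|)%N.
have Am i : i \in A -> (`|i| <= m)%N by move=> iA; exact: leq_bigmax_seq.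
near=> n.
have nN : (n < N ^ n)%N by exact: ltn_expl.
have nm : (m + `|k| <= n)%N by near: n; exact: nbhs_infty_ge.
have h1 : s k <= class_sum N s n k.
  have := has_sum_ge_partial _ (class_sumP n k) [fset (0 : int)]%fset.
  by rewrite big_seq_fset1 mulr0 addr0; apply => l; exact: s0.
rewrite distrC ger0_norm ?subr_ge0// lerBlDr.
apply: has_sum_le_bound (class_sumP n k) _ => B.
pose h (l : int) := k + (N ^ n)%N%:Z * l.
have hinj : injective h by move=> a b /addrI; nia.
rewrite (_ : \sum_(i <- B) _ = \sum_(j <- (h @` B)%fset) s j); last first.
  by rewrite big_imfset//= => ? ? _ _ /hinj.
rewrite (big_fsetID _ (pred1 k) (h @` B)%fset)/= addrC.
apply: lerD.
- set C := [fset _ in _ | _]%fset.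
  have AC : \sum_(i <- A) s i + \sum_(i <- C) s i <= t.
    have := has_sum_ge_partial s0 st (A `|` C)%fset.
    rewrite (big_fsetID _ (mem A) (A `|` C)%fset)/=.
    rewrite (_ : [fset x in (A `|` C)%fset | x \in A]%fset = A); last first.
      by apply/fsetP => i; rewrite !inE/=; case: (i \in A); rewrite //= andbF.
    rewrite (_ : [fset x in (A `|` C)%fset | x \notin A]%fset = C)//.
    apply/fsetP => i; rewrite !inE/=; case iA : (i \in A) => /=; last first.
      by rewrite andbT.
    apply/esym/negbTE/negP => /andP[/imfsetP[l /= _ il] /eqP ik].
    have := Am i iA; rewrite il /h.
    have l0 : l <> 0 by move=> l0; apply: ik; rewrite il /h l0 mulr0 addr0.
    by nia.
  have := AP A (fsubset_refl _); rewrite ltr_norml; lra.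
- have : ([fset i in (h @` B)%fset | i == k] `<=` [fset k])%fset.
    by apply/fsubsetP => i; rewrite !inE/= => /andP[].
  rewrite fsubset1 => /orP[] /eqP ->; first by rewrite big_seq_fset1.
  by rewrite big_seq_fset0.
Unshelve. all: by end_near. Qed.

End class_sums.

(** A window of [N ^ n] consecutive integers is a full set of residues modulo
[N ^ n]. *)
Lemma tower_window_sum (N : nat) (T : nat -> int -> R) (v : R) :
  (forall n k, T n k = \sum_(j < N) T n.+1 (k + (N ^ n)%N%:Z * j%:Z)) ->
  (forall k, T 0%N k = v) ->
  forall n a, \sum_(i < N ^ n) T n (a + i%:Z) = v.
Proof.
move=> TS T0; elim => [|n IH] a; first by rewrite expn0 big_ord1 addr0.
rewrite -(IH a); under [RHS]eq_bigr do rewrite TS.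
rewrite exchange_big/= expnS.
rewrite -(big_mkord xpredT (fun i => T n.+1 (a + i%:Z))) big_nat_mul big_mkord.
apply: eq_bigr => j _.
rewrite -{1}(add0n (j * N ^ n)%N) mulSn big_addn addnK big_mkord.
by apply: eq_bigr => i _; congr (T _ _); rewrite PoszD PoszM; ring.
Qed.

(** The windows are centred, so as to exhaust the integers on both sides. *)
Lemma tower_window_cofinal (N : nat) : (2 <= N)%N ->
  window (- ((N ^ n)./2)%:Z) (N ^ n) @[n --> \oo] --> summability.totally.
Proof.
move=> N2; apply: window_cofinal => m; near=> n.
have nN : (n < N ^ n)%N by exact: ltn_expl.
have nm : (m.*2.+3 <= n)%N by near: n; exact: nbhs_infty_ge.
by split; lia.
Unshelve. all: by end_near. Qed.

(** Both towers are refined in the same way, so that [T n k - T n.+1 k] bounds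
the increment of [G] at [k] and [G n k] converges, with error at most
[T n k - s k]. Over a window of length [N ^ n] these errors add up to the part
of the total [t] that the window misses, and this tends to 0. *)
Lemma tower_sum (N : nat) (G T : nat -> int -> R) (s : int -> R) (v t : R) :
  (2 <= N)%N ->
  (forall n k, G n k = \sum_(j < N) G n.+1 (k + (N ^ n)%N%:Z * j%:Z)) ->
  (forall n k, T n k = \sum_(j < N) T n.+1 (k + (N ^ n)%N%:Z * j%:Z)) ->
  (forall k, G 0%N k = v) -> (forall k, T 0%N k = t) ->
  (forall n k, `|G n k| <= T n k) ->
  (forall k, T n k @[n --> \oo] --> s k) -> has_sum s t ->
  exists2 F : int -> R, has_sum F v & forall k, G n k @[n --> \oo] --> F k.
Proof.
move=> N2 GS TS G0 T0 GT Ts st.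
have step n k : `|G n k - G n.+1 k| <= T n k - T n.+1 k.
  rewrite GS TS; case: N N2 {GS TS} => // N _.
  rewrite !big_ord_recl/= mulr0 addr0 [_ + _ - _]addrAC subrr add0r.
  rewrite [X in _ <= X]addrAC subrr add0r.
  by apply: le_trans (ler_norm_sum _ _ _) _; apply: ler_sum => j _; exact: GT.
(* [T - G] decreases in [n] and is nonnegative. *)
have cvgG k : cvgn (G ^~ k).
  have ni : nonincreasing_seq (fun n => T n k - G n k).
    by apply/nonincreasing_seqP => n; have := step n k; rewrite ler_norml; lra.
  have lb : has_lbound (range (fun n => T n k - G n k)).
    by exists 0 => _ [n _ <-]; have := GT n k; rewrite ler_norml; lra.
  have cTG := nonincreasing_is_cvgn ni lb.
  rewrite (_ : G ^~ k = (fun n => T n k) \- (fun n => T n k - G n k)).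
    by apply: is_cvgB => //; apply/cvg_ex; exists (s k); exact: Ts.
  by apply/funext => n /=; ring.
have steps n p k : (n <= p)%N -> `|G n k - G p k| <= T n k - T p k.
  move=> /subnKC <-; elim: (p - n)%N => [|m IH].
    by rewrite addn0 !subrr normr0.
  rewrite addnS; have := step (n + m)%N k; move: IH.
  by rewrite !ler_norml; lra.
pose F k := limn (G ^~ k).
have GF k : G n k @[n --> \oo] --> F k by exact: cvgG.
have dist n k : `|G n k - F k| <= T n k - s k.
  have c1 : `|G n k - G p k| @[p --> \oo] --> `|G n k - F k|.
    by apply: cvg_norm; apply: cvgB; [exact: cvg_cst|exact: GF].
  have c2 : T n k - T p k @[p --> \oo] --> T n k - s k.
    by apply: cvgB; [exact: cvg_cst|exact: Ts].
  apply: (ler_cvg_to c1 c2).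
  by near=> p; apply: steps; near: p; exact: nbhs_infty_ge.
have Fs k : `|F k| <= s k.
  have c1 : `|G n k| @[n --> \oo] --> `|F k| by apply: cvg_norm; exact: GF.
  by apply: (ler_cvg_to c1 (Ts k)); near=> n; exact: GT.
exists F => //.
have [w Fw _] := has_sum_dominated Fs st.
suff <- : w = v by [].
pose W n := window (- ((N ^ n)./2)%:Z) (N ^ n).
have FW : \sum_(k <- W n) F k @[n --> \oo] --> w.
  exact: has_sum_cofinal (tower_window_cofinal N2) Fw.
have sW : \sum_(k <- W n) s k @[n --> \oo] --> t.
  exact: has_sum_cofinal (tower_window_cofinal N2) st.
apply/eqP; rewrite -subr_eq0 -normr_le0.
have lim0 : t - \sum_(k <- W n) s k @[n --> \oo] --> (0 : R).
  by rewrite -[X in _ --> X](subrr t); apply: cvgB; [exact: cvg_cst|exact: sW].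
have limv : `|\sum_(k <- W n) F k - v| @[n --> \oo] --> `|w - v|.
  by apply: cvg_norm; apply: cvgB => //; exact: cvg_cst.
apply: (ler_cvg_to limv lim0); near=> n.
pose a := - ((N ^ n)./2)%:Z.
rewrite distrC !window_sum -(tower_window_sum GS G0 n a) -(tower_window_sum TS T0 n a).
rewrite -!sumrB; apply: le_trans (ler_norm_sum _ _ _) _.
exact: ler_sum.
Unshelve. all: by end_near. Qed.
End integer_sums.

(** * Unconditional sums of complex families *)

Section complex_sums.
Context {R : realType} {I : choiceType}.
Implicit Types (z : I -> R[i]) (u v : R[i]).

Lemma Re_add u v : complex.Re (u + v) = complex.Re u + complex.Re v.
Proof. by case: u; case: v. Qed.

Lemma Im_add u v : complex.Im (u + v) = complex.Im u + complex.Im v.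
Proof. by case: u; case: v. Qed.

Lemma Re_sub u v : complex.Re (u - v) = complex.Re u - complex.Re v.
Proof. by case: u; case: v. Qed.

Lemma Im_sub u v : complex.Im (u - v) = complex.Im u - complex.Im v.
Proof. by case: u; case: v. Qed.

Lemma Re_sum (T : Type) (r : seq T) (F : T -> R[i]) :
  complex.Re (\sum_(i <- r) F i) = \sum_(i <- r) complex.Re (F i).
Proof. by elim/big_ind2 : _ => // [? ? ? ? <- <-]; exact: Re_add. Qed.

Lemma Im_sum (T : Type) (r : seq T) (F : T -> R[i]) :
  complex.Im (\sum_(i <- r) F i) = \sum_(i <- r) complex.Im (F i).
Proof. by elim/big_ind2 : _ => // [? ? ? ? <- <-]; exact: Im_add. Qed.

Lemma normc_ge0 u : 0 <= normc u.
Proof. by case: u => a b; exact: sqrtr_ge0. Qed.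

Lemma le_Re_normc u : `|complex.Re u| <= normc u.
Proof. by case: u => a b /=; rewrite -sqrtr_sqr ler_sqrt; nra. Qed.

Lemma le_Im_normc u : `|complex.Im u| <= normc u.
Proof. by case: u => a b /=; rewrite -sqrtr_sqr ler_sqrt; nra. Qed.

Lemma normc_le_ReIm u : normc u <= `|complex.Re u| + `|complex.Im u|.
Proof.
case: u => a b /=; have a0 := normr_ge0 a; have b0 := normr_ge0 b.
rewrite -[leRHS]ger0_norm ?addr_ge0// -sqrtr_sqr ler_sqrt ?sqr_ge0//.
by rewrite -(real_normK (num_real a)) -(real_normK (num_real b)); nra.
Qed.

Lemma has_sum_complexP z u :
  summability.partial_sum (z : I -> R[i]^o) @ summability.totally --> (u : R[i]^o) <->
  has_sum (fun i => complex.Re (z i)) (complex.Re u) /\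
  has_sum (fun i => complex.Im (z i)) (complex.Im u).
Proof.
have normE (w : R[i]^o) : `|w| = (normc w)%:C%C by [].
have eC (e : R) : 0 < e -> (0 : R[i]) < e%:C%C by rewrite ltcE/= eqxx.
pose S := summability.partial_sum (z : I -> R[i]^o).
have SE A : complex.Re (S A) = \sum_(i <- A) complex.Re (z i) /\
            complex.Im (S A) = \sum_(i <- A) complex.Im (z i).
  by rewrite /S partial_sumE -Re_sum -Im_sum.
split => [/cvgrPdist_lt zu|[/has_sumP zre /has_sumP zim]].
  split; apply/has_sumP => e e0;
    have [A _ AP] := zu e%:C%C (eC e e0); exists A => B /AP;
    rewrite /= -/S normE ltcR; apply: le_lt_trans.
  - by rewrite -(SE B).1 -Re_sub; exact: le_Re_normc.
  - by rewrite -(SE B).2 -Im_sub; exact: le_Im_normc.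
apply/cvgrPdist_lt => -[e e'] /[!ltcE]/= /andP[/eqP -> e0].
have [A AP] := zre (e / 2) (divr_gt0 e0 (ltr0Sn _ _)).
have [A' AP'] := zim (e / 2) (divr_gt0 e0 (ltr0Sn _ _)).
exists (A `|` A')%fset => // B /=; rewrite fsubUset => /andP[/AP hre /AP' him].
rewrite -/S normE ltcR (le_lt_trans (normc_le_ReIm _))//.
by rewrite Re_sub Im_sub (SE B).1 (SE B).2 [e]splitr ltrD.
Qed.

Lemma complex_sumE z (a b : R) :
  has_sum (fun i => complex.Re (z i)) a -> has_sum (fun i => complex.Im (z i)) b ->
  summability.sum (z : I -> R[i]^o) = Complex a b.
Proof.
move=> za zb; apply: cvg_lim; first exact: norm_hausdorff.
by apply/has_sum_complexP.
Qed.

(** A limit would make the real and imaginary parts summable, hence absolutely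
summable; without a limit, [lim] takes its default value 0. *)
Lemma complex_sum_unbounded z :
  ~ (exists M, forall A : {fset I}, \sum_(i <- A) normc (z i) <= M) ->
  summability.sum (z : I -> R[i]^o) = 0.
Proof.
move=> unb; apply: (@getPN R[i]^o) => u /has_sum_complexP[zre zim]; apply: unb.
have [M MP] := has_sum_abs_bounded zre; have [M' MP'] := has_sum_abs_bounded zim.
exists (M + M') => A; apply: le_trans (lerD (MP A) (MP' A)).
by rewrite -big_split/=; apply: ler_sum => i _; exact: normc_le_ReIm.
Qed.

End complex_sums.

(** * Affine changes of variable and null sets *)

Lemma ae_lebesgue_filter {R : realType} :
  Filter (nbhs (almost_everywhere (@lebesgue_measure R))).
Proof. exact: ae_filter_ringOfSetsType. Qed.
#[local] Existing Instance ae_lebesgue_filter.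

Section affine_change.
Context {R : realType}.
Local Notation mu := (@lebesgue_measure R).
Implicit Types (A D : set R) (f : R -> \bar R) (a b : R).

Definition affine a b (x : R) : R := a * x + b.

Lemma measurable_affine a b : measurable_fun setT (affine a b).
Proof. by apply: measurable_funD => //; exact: measurable_funM. Qed.

Let measurable_affineR a b :
  measurable_fun setT (affine a b : measurableTypeR R -> measurableTypeR R).
Proof. exact: measurable_affine. Qed.

Lemma measurable_affine_preimage a b A :
  measurable A -> measurable (affine a b @^-1` A).
Proof. by rewrite -[_ @^-1` _]setTI => mA; exact: measurable_affine. Qed.

(** Both sides, as functions of [A], are measures that agree on intervals. *)
Lemma lebesgue_measure_affine a b A : 0 < a -> measurable A ->
  mu A = (a%:E * mu (affine a b @^-1` A))%E.
Proof.
move=> a0 mA; have a0' := ltW a0.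
pose nu' : {measure set (measurableTypeR R) -> \bar R} :=
  mscale (NngNum a0')
    (pushforward mu (affine a b : measurableTypeR R -> measurableTypeR R)).
pose nu := nu' (measurable_affineR a b).
rewrite -[RHS]/(nu A); apply: lebesgue_measure_unique => // _ [[c d] _ <-].
rewrite /nu/= /nu'/= /mscale/= /pushforward.
rewrite (_ : _ @^-1` _ = `](c - b) / a, (d - b) / a]%classic); last first.
  apply/seteqP; split => x/=; rewrite !in_itv/= /affine;
    by rewrite ltr_pdivrMr// ler_pdivlMr// ltrBlDr lerBrDr mulrC.
rewrite !lebesgue_measure_itv/= !lte_fin ltr_pM2r ?invr_gt0// ltrD2r.
case: ifPn => _; last by rewrite mule0.
by rewrite -!EFinD -EFinM; congr EFin; field; rewrite gt_eqF.
Qed.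

Lemma ge0_integral_affine a b D f : 0 < a -> measurable D ->
  measurable_fun D f -> (forall x, D x -> 0 <= f x)%E ->
  (\int[mu]_(x in D) f x =
   a%:E * \int[mu]_(x in affine a b @^-1` D) f (affine a b x))%E.
Proof.
move=> a0 mD mf f0; have a0' := ltW a0.
pose nu' : {measure set (measurableTypeR R) -> \bar R} :=
  mscale (NngNum a0')
    (pushforward mu (affine a b : measurableTypeR R -> measurableTypeR R)).
pose nu := nu' (measurable_affineR a b).
transitivity (\int[nu]_(x in D) f x)%E.
  apply: eq_measure_integral => /= A mA AD.
  by rewrite /mscale/= /pushforward -(lebesgue_measure_affine b a0 mA).
rewrite /nu /nu' ge0_integral_mscale//; congr (_ * _)%E.
by rewrite ge0_integral_pushforward// => x; rewrite inE; exact: f0.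
Qed.

Lemma integrable_affine a b D f : 0 < a -> measurable D ->
  mu.-integrable D f ->
  mu.-integrable (affine a b @^-1` D) (fun x => f (affine a b x)).
Proof.
move=> a0 mD /integrableP[mf foo].
have mpD := measurable_affine_preimage a b mD.
apply/integrableP; split.
  apply: (measurable_comp mD) => //; first by move=> _ [x ? <-].
  by apply: measurable_funTS; exact: measurable_affine.
move: foo; rewrite (ge0_integral_affine b a0 mD)//; last exact: measurableT_comp.
by move=> foo; rewrite -(@lte_pmul2l _ a%:E)// mulr_infty gtr0_sg// mul1e.
Qed.

Lemma integral_affine a b D f : 0 < a -> measurable D ->
  mu.-integrable D f ->
  (\int[mu]_(x in D) f x =
   a%:E * \int[mu]_(x in affine a b @^-1` D) f (affine a b x))%E.
Proof.
move=> a0 mD fi; have mf := measurable_int _ fi.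
rewrite integralE [in RHS]integralE muleBr//; last first.
  apply: fin_num_adde_defl; rewrite fin_numN.
  apply: integrable_neg_fin_num; first exact: measurable_affine_preimage.
  exact: integrable_affine.
rewrite (ge0_integral_affine b a0 mD (measurable_funepos mf))//.
rewrite (ge0_integral_affine b a0 mD (measurable_funeneg mf)) => [|x _]; last first.
  exact: funeneg_ge0.
by congr (_ * _ - _ * _)%E; apply: eq_integral => x _;
  rewrite ?funeposE ?funenegE.
Qed.

Lemma ae_affine a b (P : R -> Prop) : 0 < a ->
  {ae mu, forall x, P x} -> {ae mu, forall x, P (a * x + b)}.
Proof.
move=> a0 [A [mA A0 PA]]; exists (affine a b @^-1` A).
split; first exact: measurable_affine_preimage.
  move: A0; rewrite (lebesgue_measure_affine b a0 mA) => /eqP.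
  by rewrite mule_eq0 eqe gt_eqF//= => /eqP.
by move=> x /=; exact: PA.
Qed.

Lemma ae_forall_int (P : int -> R -> Prop) :
  (forall k, {ae mu, forall x, P k x}) -> {ae mu, forall x, forall k, P k x}.
Proof.
move=> aeP.
have : {ae mu, forall x, forall n : nat, P n%:Z x /\ P (- n%:Z) x}.
  apply: ae_foralln => n.
  by move: (aeP n%:Z) (aeP (- n%:Z)); apply: filterS2 => x ? ?; split.
apply: filterS => x Px [n|n]; first exact: (Px n).1.
by rewrite NegzE; exact: (Px n.+1).2.
Qed.

(** Only countably many affine maps occur, and each of them preserves null sets. *)
Lemma ae_dilations_translations (N : nat) (P : R -> Prop) : (0 < N)%N ->
  {ae mu, forall x, P x} ->
  {ae mu, forall x, forall (n : nat) (k : int),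
     P ((x + 2 * k%:~R * pi) / N%:R ^+ n)}.
Proof.
move=> N0 aeP; apply: ae_foralln => n; apply: ae_forall_int => k.
have a0 : 0 < (N%:R ^+ n : R)^-1 by rewrite invr_gt0 exprn_gt0// ltr0n.
apply: filterS (ae_affine (2 * k%:~R * pi / N%:R ^+ n) a0 aeP) => x.
rewrite /= (_ : (x + 2 * k%:~R * pi) / N%:R ^+ n =
  (N%:R ^+ n)^-1 * x + 2 * k%:~R * pi / N%:R ^+ n)//; ring.
Qed.

Lemma periodic_int {T : Type} (f : R -> T) :
  (forall x, f (x + 2 * pi) = f x) ->
  forall (k : int) x, f (x + 2 * k%:~R * pi) = f x.
Proof.
move=> per.
have pern (n : nat) x : f (x + 2 * n%:R * pi) = f x.
  elim: n => [|n IH]; first by rewrite mulr0 mul0r addr0.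
  by rewrite -IH -(per (x + 2 * n%:R * pi)) -natr1; congr f; ring.
case=> n x; first exact: pern.
rewrite NegzE mulrNz -(pern n.+1); congr f; rewrite -pmulrn; ring.
Qed.

Lemma circle_dom_translate (x : R) :
  exists k : int, circle_dom (x + 2 * k%:~R * pi).
Proof.
have p0 : 0 < 2 * pi :> R by rewrite mulr_gt0// pi_gt0.
exists (- Num.floor (x / (2 * pi))); rewrite /circle_dom/= in_itv/=.
have := floor_itv (x / (2 * pi)) => /andP[].
rewrite intrD ler_pdivlMr// ltr_pdivrMr// mulrNz; lra.
Qed.

Lemma ae_periodic (P : R -> Prop) :
  (forall x, P (x + 2 * pi) <-> P x) ->
  {ae mu, forall x, circle_dom x -> P x} -> {ae mu, forall x, P x}.
Proof.
move=> perP aeP.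
have perE := periodic_int (fun x => propext (perP x)).
have : {ae mu, forall x, forall k : int,
    circle_dom (x + 2 * k%:~R * pi) -> P (x + 2 * k%:~R * pi)}.
  apply: ae_forall_int => k.
  apply: filterS (ae_affine (2 * k%:~R * pi) ltr01 aeP) => x.
  by rewrite mul1r.
apply: filterS => x Px; have [k /Px] := circle_dom_translate x.
by rewrite perE.
Qed.

End affine_change.

(** * Cosine and sine transforms of an interval *)

Section trig_transform.
Context {R : realType}.
Local Notation mu := (@lebesgue_measure R).
Variables (c d : R -> R) (a b : R).
Hypothesis ab : a < b.
Hypothesis c_cont : continuous c.
Hypothesis c_le1 : forall y, `|c y| <= 1.

(** For cosine and sine, the two components of the Fourier transform of the
indicator of the interval. *)
Definition itv_transform (c : R -> R) (a b t : R) : R :=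
  \int[mu]_(x in `[a, b]) c (t * x).

Let mc : measurable_fun setT c.
Proof. exact: continuous_measurable_fun. Qed.

Let mct (t : R) : measurable_fun setT (fun x : R => c (t * x)).
Proof. by apply: measurableT_comp => //; exact: measurable_funM. Qed.

Let mu_itv : mu `[a, b] = (b - a)%:E.
Proof. by rewrite lebesgue_measure_itv/= lte_fin ab -EFinD. Qed.

Let mu_itv_fin : (mu `[a, b] < +oo)%E.
Proof. by rewrite mu_itv ltry. Qed.

Let int_ct (t : R) : mu.-integrable `[a, b] (EFin \o (fun x : R => c (t * x))).
Proof.
apply: measurable_bounded_integrable => //.
- exact: measurable_funS (mct t).
- by exists 1; split => // M M1 x _; exact: le_trans (c_le1 _) (ltW M1).
Qed.

Lemma itv_transform_le_length t : `|itv_transform c a b t| <= b - a.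
Proof.
rewrite /itv_transform; apply: le_trans (le_normr_Rintegral _ (int_ct t)) _ => //.
apply: (@le_trans _ _ (\int[mu]_(x in `[a, b]) 1)).
  apply: le_Rintegral => //.
    exact: integrable_norm.
  apply: measurable_bounded_integrable => //.
  by exists 1; split => // M M1 x _ /=; rewrite normr1 ltW.
by rewrite Rintegral_cst//= lebesgue_measure_itv/= lte_fin ab mul1r.
Qed.

Section primitive.
Hypothesis dc : forall y : R, is_derive y 1 d (c y).
Hypothesis d_le1 : forall y, `|d y| <= 1.

(** In the variable [x], the function [t * c (t * x)] has the bounded primitive
[d (t * x)]. *)
Lemma itv_transform_decay t : `|t * itv_transform c a b t| <= 2.
Proof.
have der (x : R) : is_derive x 1 (fun x : R => d (t * x)) (t * c (t * x)).
  have -> : (fun x : R => d (t * x)) = d \o (fun x => t *: (x : R^o)) by [].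
  rewrite (_ : t * c (t * x) = c (t *: (x : R^o)) * (t *: 1)).
    by apply: is_derive1_comp.
  by rewrite [_ *: 1]mulr1 mulrC.
have cd : continuous (fun x : R => d (t * x)).
  by move=> x; apply: differentiable_continuous; exact/derivable1_diffP.
have ctc : continuous (fun x : R => t * c (t * x)).
  move=> x; apply: cvgMr; apply: continuous_comp; last exact: c_cont.
  exact: mulrl_continuous.
have -> : t * itv_transform c a b t = d (t * b) - d (t * a).
  rewrite /itv_transform -RintegralZl//.
  rewrite /Rintegral (@continuous_FTC2 _ _ (fun x => d (t * x)))//.
  - by apply: continuous_subspaceT.
  - split.
    + by move=> x _; exact: ex_derive.
    + by apply: cvg_at_right_filter; exact: cd.
    + by apply: cvg_at_left_filter; exact: cd.
  - by move=> x _; rewrite derive1E; exact: derive_val.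
rewrite (le_trans (ler_normB _ _))// (_ : 2 = 1 + 1)//.
by apply: lerD; exact: d_le1.
Qed.

(** The first summand takes care of small [t], the second of large [t]. *)
Lemma itv_transform_sqr_le t :
  itv_transform c a b t ^+ 2 <= ((b - a) ^+ 2 + 4) * (oneDsqr t)^-1.
Proof.
rewrite ler_pdivlMr ?oneDsqr_gt0// /oneDsqr mulrDr mulr1 -exprMn [_ * t]mulrC.
apply: lerD; rewrite -[_ ^+ 2]real_normK ?num_real//.
  by rewrite lerXn2r ?nnegrE ?normr_ge0 ?subr_ge0 ?(ltW ab)// itv_transform_le_length.
have -> : (4 : R) = 2 ^+ 2 by rewrite expr2; ring.
by rewrite lerXn2r ?nnegrE ?normr_ge0// itv_transform_decay.
Qed.

End primitive.

Section fubini.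
Variable p : R -> R.
Hypothesis ip : mu.-integrable setT (EFin \o p).

Let f (z : R * R) : \bar R := (p z.2 * c (z.2 * z.1) * \1_(`[a, b]) z.1)%:E.

Let mp : measurable_fun setT p.
Proof. by apply/measurable_EFinP; exact: measurable_int ip. Qed.

Let mf : measurable_fun setT f.
Proof.
apply/measurable_EFinP; apply: measurable_funM; last first.
  by apply: measurableT_comp => //; exact: measurable_fst.
apply: measurable_funM; first by apply: measurableT_comp => //; exact: measurable_snd.
apply: measurableT_comp => //; apply: measurable_funM.
  exact: measurable_snd.
exact: measurable_fst.
Qed.

Lemma integrable_trig_kernel x : mu.-integrable setT (EFin \o (fun t => p t * c (t * x))).
Proof.
apply: (le_integrable _ _ _ ip) => //.
  apply/measurable_EFinP; apply: measurable_funM => //.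
  by apply: measurableT_comp => //; exact: measurable_funM.
by move=> t _ /=; rewrite lee_fin normrM ler_piMr.
Qed.

Let ipc := integrable_trig_kernel.

Let intf : (mu \x mu)%E.-integrable setT f.
Proof.
apply/integrable21ltyP => //.
apply: (@le_lt_trans _ _ (\int[mu]_t ((b - a)%:E * `|(p t)%:E|))%E).
  apply: ge0_le_integral => //.
  - by move=> t _; exact: integral_ge0.
  - apply: (@measurable_fun_fubini_tonelli_G _ _ _ _ _ mu (abse \o f)) => //=.
    exact: measurableT_comp.

  - apply: emeasurable_funM => //; apply: measurableT_comp => //.
    exact/measurable_EFinP.
  - move=> t _.
    apply: (@le_trans _ _ (\int[mu]_x (`|p t|%:E * (\1_(`[a, b]) x)%:E))%E).
      apply: ge0_le_integral => //.
      + apply: measurableT_comp => //; apply/measurable_EFinP.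
        apply: measurable_funM; last exact: measurable_indic.
        exact: (measurable_funM (@measurable_cst _ _ _ _ setT (p t)) (mct t)).

      + by apply: emeasurable_funM => //; exact/measurable_EFinP.
      + move=> x _; rewrite /f/= -EFinM lee_fin !normrM ler_pM//.
          by rewrite ler_piMr.
        by rewrite ger0_norm// indicE.
    rewrite ge0_integralZl//; [|exact/measurable_EFinP..].
    by rewrite integral_indic// setIT/= mu_itv muleC.
apply: (@le_lt_trans _ _ ((b - a)%:E * \int[mu]_t `|(p t)%:E|)%E).
  rewrite ge0_integralZl//; last by rewrite lee_fin subr_ge0 ltW.
  by apply: measurableT_comp => //; exact/measurable_EFinP.
by case/integrableP : ip => _ poo; rewrite lte_mul_pinfty// lee_fin subr_ge0 ltW.
Qed.

Lemma trig_integral_itv_integrable :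
  mu.-integrable setT
    (EFin \o (fun x => (\int[mu]_t (p t * c (t * x))) * \1_(`[a, b]) x)).
Proof.
apply: eq_integrable (integrable_fubini_F intf) => // x _.
rewrite /fubini_F /f/= EFinM /Rintegral fineK; last by apply: integrable_fin_num => //; exact: (ipc x).
rewrite -integralZr//; last exact: (ipc x).
Qed.

(** Fubini on the product of the line with the interval, where the kernel is
bounded. *)
Lemma trig_integral_itvE :
  \int[mu]_x ((\int[mu]_t (p t * c (t * x))) * \1_(`[a, b]) x) =
  \int[mu]_t (p t * itv_transform c a b t).
Proof.
rewrite /Rintegral; congr fine.
transitivity (\int[mu]_x fubini_F mu f x)%E.
  apply: eq_integral => x _.
  rewrite /fubini_F /f/= EFinM /Rintegral fineK; last by apply: integrable_fin_num => //; exact: (ipc x).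
  by rewrite -integralZr//; exact: (ipc x).
rewrite (Fubini intf); apply: eq_integral => t _ /=.
rewrite EFinM /itv_transform /Rintegral fineK; last first.
  by apply: integrable_fin_num => //; exact: int_ct.
rewrite -integralZl//; last exact: int_ct.
rewrite [RHS]integral_mkcond; apply: eq_integral => x _.
rewrite patchE /f/= indicE; case: ifPn => _; first by rewrite mulr1 EFinM.
by rewrite mulr0.
Qed.

End fubini.

Lemma measurable_itv_transform : measurable_fun setT (itv_transform c a b).
Proof.
(* Adding 1 to [c] makes the integrand nonnegative, as Tonelli requires. *)
pose f (z : R * R) : \bar R := ((c (z.1 * z.2) + 1) * \1_(`[a, b]) z.2)%:E.
have mf : measurable_fun setT f.
  apply/measurable_EFinP; apply: measurable_funM; last first.
    by apply: measurableT_comp => //; exact: measurable_snd.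
  apply: measurable_funD => //; apply: measurableT_comp => //.
  by apply: measurable_funM; [exact: measurable_fst|exact: measurable_snd].
have f0 z : (0 <= f z)%E.
  by rewrite lee_fin mulr_ge0//; have := c_le1 (z.1 * z.2); rewrite ler_norml; lra.
have := @measurable_fun_fubini_tonelli_F _ _ _ _ _ mu f mf f0.
rewrite [X in measurable_fun _ X -> _](_ : _ = EFin \o (fun t => itv_transform c a b t + (b - a))).
  move=> /measurable_EFinP mK.
  rewrite (_ : itv_transform c a b = (fun t => itv_transform c a b t + (b - a)) \- cst (b - a)).
    exact: measurable_funB.
  by apply/funext => t /=; rewrite addrK.
apply/funext => t.
rewrite /fubini_F/= EFinD /itv_transform /Rintegral fineK; last first.
  by apply: integrable_fin_num => //; exact: int_ct.
rewrite -mu_itv -[mu _]mul1e -integral_cst// -integralD//; last 2 first.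
  exact: int_ct.
  apply: measurable_bounded_integrable => //.
  by exists 1; split => // M M1 x _ /=; rewrite normr1 ltW.
rewrite [RHS]integral_mkcond; apply: eq_integral => x _.
rewrite patchE /f/= indicE; case: ifPn => _; first by rewrite mulr1 EFinD.
by rewrite mulr0.
Qed.

End trig_transform.

(** * Square integrable functions *)

Section square_integrable.
Context {R : realType}.
Local Notation mu := (@lebesgue_measure R).
Implicit Types (f g : R -> R) (w : R -> R[i]).

Lemma integral_oneDsqr : (\int[mu]_x (oneDsqr x)^-1%:E < +oo)%E.
Proof.
rewrite ge0_symfun_integralT.
- by rewrite -set_itvcy integral0y_oneDsqr -EFinM ltry.
- by move=> x; rewrite invr_ge0 ltW// oneDsqr_gt0.
- exact: continuous_oneDsqrV.
- by move=> x; rewrite /= /oneDsqr sqrrN.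
Qed.

Lemma Lnorm2E (f : R -> \bar R) :
  Lnorm mu 2%:E f = ((\int[mu]_x (`|f x| `^ 2)) `^ 2^-1)%E.
Proof. by rewrite unlock. Qed.

Lemma Lfun2P f : measurable_fun setT f ->
  (\int[mu]_x (f x ^+ 2)%:E < +oo)%E -> f \in Lfun mu 2%:E.
Proof.
move=> mf foo; rewrite inE; apply/andP; split; rewrite inE//=.
rewrite /finite_norm Lnorm2E poweR_lty//.
by under eq_integral => x _ do
  rewrite /= powR_mulrn// real_normK ?num_real//.
Qed.

Lemma Lnorm2_le f g : measurable_fun setT f -> measurable_fun setT g ->
  (forall x, `|f x| <= `|g x|) ->
  (Lnorm mu 2%:E (EFin \o f) <= Lnorm mu 2%:E (EFin \o g))%E.
Proof.
move=> mf mg fg; rewrite !Lnorm2E gt0_ler_poweR//.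
- by rewrite in_itv/= leey andbT; apply: integral_ge0 => x _; rewrite lee_fin powR_ge0.
- by rewrite in_itv/= leey andbT; apply: integral_ge0 => x _; rewrite lee_fin powR_ge0.
have mpow (k : R -> R) : measurable_fun setT k ->
    measurable_fun setT (fun x => (`|(EFin \o k) x| `^ 2)%E).
  move=> mk; rewrite (_ : (fun x => _) = EFin \o (fun x => k x ^+ 2)).
    by apply/measurable_EFinP; exact: measurable_funX.
  by apply/funext => x; rewrite /= powR_mulrn// real_normK ?num_real.
apply: ge0_le_integral => //.
- by move=> x _; exact: poweR_ge0.
- exact: mpow.
- exact: mpow.
- by move=> x _; rewrite /= lee_fin !powR_mulrn// lerXn2r ?nnegrE.
Qed.

Lemma measurable_normc w : cmeasurable w -> measurable_fun setT (fun x => normc (w x)).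
Proof.
move=> [mre mim].
rewrite (_ : (fun x => normc (w x)) =
  Num.sqrt \o (fun x => complex.Re (w x) ^+ 2 + complex.Im (w x) ^+ 2)); last first.
  by apply/funext => x /=; case: (w x).
apply: measurableT_comp; first by apply: continuous_measurable_fun; exact: sqrt_continuous.
by apply: measurable_funD; exact: measurable_funX.
Qed.

Lemma LnormC2_sqr w : (\int[mu]_x (normc (w x) ^+ 2)%:E = LnormC 2%:E w `^ 2)%E.
Proof.
rewrite /LnormC poweR_Lnorm ?pnatr_eq0//.
by apply: eq_integral => x _; rewrite /= ger0_norm ?normc_ge0// powR_mulrn ?normc_ge0.
Qed.

Lemma LpR2_normc w : LpR 2%:E w -> (fun x => normc (w x)) \in Lfun mu 2%:E.
Proof.
move=> [mw woo]; apply: Lfun2P; first exact: measurable_normc.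
by rewrite LnormC2_sqr poweR_lty.
Qed.

Lemma Lfun2_le f g : measurable_fun setT f -> g \in Lfun mu 2%:E ->
  (forall x, `|f x| <= g x) -> f \in Lfun mu 2%:E.
Proof.
move=> mf g2 fg; apply: Lfun2P => //.
have mg : measurable_fun setT g by move: g2; rewrite inE => /andP[]; rewrite inE.
have := integrable_lty measurableT (Lfun2_integrable_sqr g2); apply: le_lt_trans.
apply: ge0_le_integral => //=.
- by move=> x _; rewrite lee_fin sqr_ge0.
- by apply/measurable_EFinP; exact: measurable_funX.
- by apply/measurable_EFinP; exact: measurable_funX.
- move=> x _; rewrite lee_fin -[f x ^+ 2]real_normK ?num_real//.
  by rewrite lerXn2r ?nnegrE//; exact: le_trans (fg x).
Qed.

Lemma LpR2_Re w : LpR 2%:E w -> (fun x => complex.Re (w x)) \in Lfun mu 2%:E.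
Proof.
move=> w2; apply: (Lfun2_le _ (LpR2_normc w2)); first exact: w2.1.1.
by move=> x; exact: le_Re_normc.
Qed.

Lemma LpR2_Im w : LpR 2%:E w -> (fun x => complex.Im (w x)) \in Lfun mu 2%:E.
Proof.
move=> w2; apply: (Lfun2_le _ (LpR2_normc w2)); first exact: w2.1.2.
by move=> x; exact: le_Im_normc.
Qed.

Lemma integrable_Lfun2M f g : f \in Lfun mu 2%:E -> g \in Lfun mu 2%:E ->
  mu.-integrable setT (EFin \o (fun x => f x * g x)).
Proof. by move=> f2 g2; apply/Lfun1_integrable; exact: Lfun2_mul_Lfun1. Qed.

Lemma itv_transform_Lfun2 (c d : R -> R) (a b : R) : a < b ->
  continuous c -> (forall y, `|c y| <= 1) ->
  (forall y : R, is_derive y 1 d (c y)) -> (forall y, `|d y| <= 1) ->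
  itv_transform c a b \in Lfun mu 2%:E.
Proof.
move=> ab cc c1 dc d1; have mK := measurable_itv_transform ab cc c1.
have mo : measurable_fun setT (fun x : R => (oneDsqr x)^-1%:E).
  apply/measurable_EFinP.
  by apply: continuous_measurable_fun; exact: continuous_oneDsqrV.
apply: Lfun2P => //.
apply: (@le_lt_trans _ _
  (\int[mu]_x (((b - a) ^+ 2 + 4)%:E * (oneDsqr x)^-1%:E))%E).
  apply: ge0_le_integral => //.
  - by move=> x _; rewrite lee_fin sqr_ge0.
  - by apply/measurable_EFinP; exact: measurable_funX.
  - exact: emeasurable_funM.
  - move=> x _; rewrite -EFinM lee_fin.
    exact: (itv_transform_sqr_le ab cc c1 dc d1).
rewrite ge0_integralZl//; last by rewrite lee_fin addr_ge0// sqr_ge0.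
rewrite lte_mul_pinfty//; last exact: integral_oneDsqr.
by rewrite lee_fin addr_ge0// sqr_ge0.
Qed.

(** By the Cauchy-Schwarz inequality. The bound by the modulus of [w] lets the
lemma be used for real and imaginary parts. *)
Lemma Lnorm2_pairing_cvg0 (v : nat -> R -> R) (w : nat -> R -> R[i]) (K : R -> R) :
  (forall n, measurable_fun setT (v n)) ->
  (forall n x, `|v n x| <= normc (w n x)) ->
  (forall n, cmeasurable (w n)) -> K \in Lfun mu 2%:E ->
  LnormC 2%:E (w n) @[n --> \oo] --> 0%E ->
  (\int[mu]_x (v n x * K x)) @[n --> \oo] --> (0 : R).
Proof.
move=> mv vw mw K2 w0.
have mK : measurable_fun setT K by move: K2; rewrite inE => /andP[]; rewrite inE.
pose M := Lnorm mu 2%:E (EFin \o K).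
have Mfin : M \is a fin_num.
  rewrite ge0_fin_numE ?Lnorm_ge0//.
  by move: K2; rewrite inE => /andP[_]; rewrite inE.
have bound n : LnormC 2%:E (w n) \is a fin_num ->
    `|\int[mu]_x (v n x * K x)| <= fine (LnormC 2%:E (w n)) * fine M.
  move=> wfin.
  have w2 : LpR 2%:E (w n) by split => //; rewrite -ge0_fin_numE ?Lnorm_ge0.
  have v2 : v n \in Lfun mu 2%:E := Lfun2_le (mv n) (LpR2_normc w2) (vw n).
  rewrite -lee_fin EFinM !fineK// (EFin_normr_Rintegral _ (integrable_Lfun2M v2 K2))//.
  apply: le_trans (le_abse_integral _ _ _) _ => //.
    by case/integrableP : (integrable_Lfun2M v2 K2).
  rewrite -Lnorm1.
  have : (Lnorm mu 1 (EFin \o (v n \* K)%R) <=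
      Lnorm mu 2%:E (EFin \o v n) * Lnorm mu 2%:E (EFin \o K))%E.
    apply: (@hoelder _ _ _ mu (v n) K 2 2) => //; first exact: mv.
    by rewrite [RHS]splitr !div1r.
  move=> /le_trans; apply.
  apply: lee_wpmul2r; first exact: Lnorm_ge0.
  apply: Lnorm2_le => //; first exact: measurable_normc.
  by move=> x; rewrite [leRHS]ger0_norm ?normc_ge0.
move/fine_cvgP : w0 => [wfin w0].
have w0M : fine (LnormC 2%:E (w n)) * fine M @[n --> \oo] --> (0 : R).
  by rewrite -[X in _ --> X](mul0r (fine M)); apply: cvgM => //; exact: cvg_cst.
apply/cvgr0Pnorm_le => e e0.
move/cvgr0Pnorm_le : w0M => /(_ e e0).
apply: filterS2 wfin => n wfin; apply: le_trans.
by apply: le_trans (bound n wfin) _; exact: ler_norm.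
Qed.

End square_integrable.

(** * The Fourier transform tested on intervals *)

Section weak_fourier.
Context {R : realType}.
Local Notation mu := (@lebesgue_measure R).
Implicit Types (p : R -> R) (u psi g : R -> R[i]) (a b : R).

Lemma Lnorm2_pairing_cvg (v : nat -> R -> R) (v0 : R -> R) (w : nat -> R -> R[i])
    (K : R -> R) :
  (forall n, measurable_fun setT (v n)) -> measurable_fun setT v0 ->
  (forall n x, `|v n x - v0 x| <= normc (w n x)) ->
  (forall n, cmeasurable (w n)) -> K \in Lfun mu 2%:E ->
  (forall n, mu.-integrable setT (EFin \o (fun x => v n x * K x))) ->
  mu.-integrable setT (EFin \o (fun x => v0 x * K x)) ->
  LnormC 2%:E (w n) @[n --> \oo] --> 0%E ->
  (\int[mu]_x (v n x * K x)) @[n --> \oo] --> (\int[mu]_x (v0 x * K x)).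
Proof.
move=> mv mv0 vw mw K2 iv iv0 w0.
have mvv n : measurable_fun setT (fun x => v n x - v0 x) by exact: measurable_funB.
have := Lnorm2_pairing_cvg0 mvv vw mw K2 w0.
rewrite (_ : (fun n => \int[mu]_x ((v n x - v0 x) * K x)) =
    (fun n => \int[mu]_x (v n x * K x) - \int[mu]_x (v0 x * K x))); last first.
  apply/funext => n; rewrite -RintegralB//.
  by apply: eq_Rintegral => x _; rewrite mulrBl.
by move=> h; apply/subr_cvg0.
Qed.

Lemma LpR1_integrable u : LpR 1%:E u ->
  mu.-integrable setT (EFin \o (fun t => complex.Re (u t))) /\
  mu.-integrable setT (EFin \o (fun t => complex.Im (u t))).
Proof.
move=> [mu_ uoo].
have nu : mu.-integrable setT (EFin \o (fun t => normc (u t))).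
  apply/integrableP; split; first by apply/measurable_EFinP; exact: measurable_normc.
  by move: uoo; rewrite /LnormC Lnorm1.
split; apply: (le_integrable _ _ _ nu) => //.
- by apply/measurable_EFinP; exact: mu_.1.
- move=> x _; rewrite /= lee_fin [leRHS]ger0_norm ?normc_ge0//; exact: le_Re_normc.
- by apply/measurable_EFinP; exact: mu_.2.
- move=> x _; rewrite /= lee_fin [leRHS]ger0_norm ?normc_ge0//; exact: le_Im_normc.
Qed.

Lemma cos_norm_le1 (y : R) : `|cos y| <= 1.
Proof. by rewrite ler_norml cos_geN1 cos_le1. Qed.

Lemma sin_norm_le1 (y : R) : `|sin y| <= 1.
Proof. by rewrite ler_norml sin_geN1 sin_le1. Qed.

Lemma fourierL1E u x : LpR 1%:E u ->
  complex.Re (fourierL1 u x) =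
    \int[mu]_t (complex.Re (u t) * cos (t * x)) +
    \int[mu]_t (complex.Im (u t) * sin (t * x)) /\
  complex.Im (fourierL1 u x) =
    \int[mu]_t (complex.Im (u t) * cos (t * x)) -
    \int[mu]_t (complex.Re (u t) * sin (t * x)).
Proof.
move=> /LpR1_integrable[ire iim].
have cc := @continuous_cos R; have cs := @continuous_sin R.
have ircos := integrable_trig_kernel cc cos_norm_le1 ire x.
have irsin := integrable_trig_kernel cs sin_norm_le1 ire x.
have iicos := integrable_trig_kernel cc cos_norm_le1 iim x.
have iisin := integrable_trig_kernel cs sin_norm_le1 iim x.
rewrite /fourierL1 /cintegral/= -RintegralD// -RintegralB//.
by split; apply: eq_Rintegral => t _; rewrite /expNi; case: (u t) => r i /=; ring.
Qed.

(** Cut off to a bounded interval, the integral is measurable by Fubini; at a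
given point the cut-off has no effect once the interval is large. *)
Lemma measurable_trig_integral (c : R -> R) p : continuous c ->
  (forall y, `|c y| <= 1) -> mu.-integrable setT (EFin \o p) ->
  measurable_fun setT (fun x => \int[mu]_t (p t * c (t * x))).
Proof.
move=> cc c1 ip.
apply: (measurable_fun_cvg (h := fun n x => (\int[mu]_t (p t * c (t * x))) *
    \1_(`[- n.+1%:R, n.+1%:R]) x)).
  move=> n; apply/measurable_EFinP.
  have nn : - n.+1%:R < n.+1%:R :> R by have := ltr0Sn R n; lra.
  exact: measurable_int (trig_integral_itv_integrable nn cc c1 ip).
move=> x _; apply: cvg_near_cst.
near=> n.
rewrite indicE mem_set ?mulr1//= in_itv/= -ler_norml.
have xn : `|x| <= n%:R by near: n; exact: nbhs_infty_ger.
by rewrite (le_trans xn)// ler_nat.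
Unshelve. all: by end_near. Qed.

Lemma cmeasurable_fourierL1 u : LpR 1%:E u -> cmeasurable (fourierL1 u).
Proof.
move=> u1; have [ire iim] := LpR1_integrable u1.
have cc := @continuous_cos R; have cs := @continuous_sin R.
have rc := measurable_trig_integral cc cos_norm_le1 ire.
have rs := measurable_trig_integral cs sin_norm_le1 ire.
have ic := measurable_trig_integral cc cos_norm_le1 iim.
have iS := measurable_trig_integral cs sin_norm_le1 iim.
split.
- have := measurable_funD rc iS; congr measurable_fun.
  by apply/funext => x; rewrite (fourierL1E x u1).1.
- have := measurable_funB ic rs; congr measurable_fun.
  by apply/funext => x; rewrite (fourierL1E x u1).2.
Qed.

Lemma indic_itv_Lfun2 a b : (\1_(`[a, b]) : R -> R) \in Lfun mu 2%:E.
Proof.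
apply: Lfun2P; first exact: measurable_indic.
have -> : (\int[mu]_x (\1_(`[a, b]) x ^+ 2)%:E = \int[mu]_x (\1_(`[a, b]) x)%:E)%E.
  apply: eq_integral => x _; congr EFin.
  by rewrite indicE; case: (_ \in _); rewrite ?expr1n ?expr0n.
rewrite integral_indic// setIT/= lebesgue_measure_itv/=.
by case: ifPn => // _; rewrite -EFinD ltry.
Qed.

Lemma cos_transform_Lfun2 a b : a < b -> itv_transform cos a b \in Lfun mu 2%:E.
Proof.
move=> ab; apply: (itv_transform_Lfun2 (d := sin) ab).
- exact: continuous_cos.
- exact: cos_norm_le1.
- exact: sin_norm_le1.
Qed.

Lemma sin_transform_Lfun2 a b : a < b -> itv_transform sin a b \in Lfun mu 2%:E.
Proof.
move=> ab; apply: (itv_transform_Lfun2 (d := \- cos) ab).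
- exact: continuous_sin.
- exact: sin_norm_le1.
- by move=> y; rewrite -[sin y]opprK; apply: is_deriveN; exact: is_derive_cos.
- by move=> y; rewrite /= normrN; exact: cos_norm_le1.
Qed.

(** For integrable functions this is the multiplication formula, with the
indicator of the interval as test function. It passes to limits in L^2, as the
transform of that indicator is square integrable. *)
Lemma is_fourier_itv psi g a b : a < b -> is_fourier psi g ->
  \int[mu]_x (complex.Re (g x) * \1_(`[a, b]) x) =
    \int[mu]_t (complex.Re (psi t) * itv_transform cos a b t) +
    \int[mu]_t (complex.Im (psi t) * itv_transform sin a b t) /\
  \int[mu]_x (complex.Im (g x) * \1_(`[a, b]) x) =
    \int[mu]_t (complex.Im (psi t) * itv_transform cos a b t) -
    \int[mu]_t (complex.Re (psi t) * itv_transform sin a b t).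
Proof.
move=> ab [psi2 g2 [u [u12 upsi ug]]].
have cc := @continuous_cos R; have cs := @continuous_sin R.
have u1 n := (u12 n).1; have u2 n := (u12 n).2.
have mpsi := psi2.1; have mg := g2.1.
have mu_ n : cmeasurable (u n) := (u1 n).1.
have mhat n := cmeasurable_fourierL1 (u1 n).
have mB (w w' : R -> R[i]) : cmeasurable w -> cmeasurable w' -> cmeasurable (w \- w').
  move=> [? ?] [? ?]; split.
  - rewrite (_ : (fun x => _) = (fun x => complex.Re (w x)) \- (fun x => complex.Re (w' x))).
      exact: measurable_funB.
    by apply/funext => x; rewrite /= Re_sub.
  - rewrite (_ : (fun x => _) = (fun x => complex.Im (w x)) \- (fun x => complex.Im (w' x))).
      exact: measurable_funB.
    by apply/funext => x; rewrite /= Im_sub.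
have K2 := indic_itv_Lfun2 a b.
have C2 := cos_transform_Lfun2 ab; have S2 := sin_transform_Lfun2 ab.
have ReP (K : R -> R) : K \in Lfun mu 2%:E ->
    \int[mu]_t (complex.Re (u n t) * K t) @[n --> \oo] -->
    \int[mu]_t (complex.Re (psi t) * K t).
  move=> KL; apply: (Lnorm2_pairing_cvg _ _ _ _ KL _ _ upsi).
  - by move=> n; exact: (mu_ n).1.
  - exact: mpsi.1.
  - by move=> n x; rewrite -Re_sub; exact: le_Re_normc.
  - by move=> n; exact: mB.
  - by move=> n; apply: integrable_Lfun2M => //; exact: LpR2_Re.
  - by apply: integrable_Lfun2M => //; exact: LpR2_Re.
have ImP (K : R -> R) : K \in Lfun mu 2%:E ->
    \int[mu]_t (complex.Im (u n t) * K t) @[n --> \oo] -->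
    \int[mu]_t (complex.Im (psi t) * K t).
  move=> KL; apply: (Lnorm2_pairing_cvg _ _ _ _ KL _ _ upsi).
  - by move=> n; exact: (mu_ n).2.
  - exact: mpsi.2.
  - by move=> n x; rewrite -Im_sub; exact: le_Im_normc.
  - by move=> n; exact: mB.
  - by move=> n; apply: integrable_Lfun2M => //; exact: LpR2_Im.
  - by apply: integrable_Lfun2M => //; exact: LpR2_Im.
have irc n := trig_integral_itv_integrable ab cc cos_norm_le1 (LpR1_integrable (u1 n)).1.
have irs n := trig_integral_itv_integrable ab cs sin_norm_le1 (LpR1_integrable (u1 n)).1.
have iic n := trig_integral_itv_integrable ab cc cos_norm_le1 (LpR1_integrable (u1 n)).2.
have iis n := trig_integral_itv_integrable ab cs sin_norm_le1 (LpR1_integrable (u1 n)).2.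
have hatRe n x : complex.Re (fourierL1 (u n) x) * \1_(`[a, b]) x =
    (\int[mu]_t (complex.Re (u n t) * cos (t * x))) * \1_(`[a, b]) x +
    (\int[mu]_t (complex.Im (u n t) * sin (t * x))) * \1_(`[a, b]) x.
  by rewrite (fourierL1E x (u1 n)).1 mulrDl.
have hatIm n x : complex.Im (fourierL1 (u n) x) * \1_(`[a, b]) x =
    (\int[mu]_t (complex.Im (u n t) * cos (t * x))) * \1_(`[a, b]) x -
    (\int[mu]_t (complex.Re (u n t) * sin (t * x))) * \1_(`[a, b]) x.
  by rewrite (fourierL1E x (u1 n)).2 mulrBl.
split.
- have lhs : \int[mu]_x (complex.Re (fourierL1 (u n) x) * \1_(`[a, b]) x)
      @[n --> \oo] --> \int[mu]_x (complex.Re (g x) * \1_(`[a, b]) x).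
    apply: (Lnorm2_pairing_cvg _ _ _ _ K2 _ _ ug).
    + by move=> n; exact: (mhat n).1.
    + exact: mg.1.
    + by move=> n x; rewrite -Re_sub; exact: le_Re_normc.
    + by move=> n; exact: mB.
    + move=> n; have := integrableD measurableT (irc n) (iis n).
      by congr integrable; apply/funext => x /=; rewrite hatRe EFinD.
    + by apply: integrable_Lfun2M => //; exact: LpR2_Re.
  have rhs := cvgD (ReP _ C2) (ImP _ S2).
  apply: (cvg_unique (@norm_hausdorff _ R) lhs).
  have -> : (fun n => \int[mu]_x (complex.Re (fourierL1 (u n) x) * \1_(`[a, b]) x)) =
      (fun n => \int[mu]_t (complex.Re (u n t) * itv_transform cos a b t) +
        \int[mu]_t (complex.Im (u n t) * itv_transform sin a b t)); last exact: rhs.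
  apply/funext => n; transitivity (\int[mu]_x (
      (\int[mu]_t (complex.Re (u n t) * cos (t * x))) * \1_(`[a, b]) x +
      (\int[mu]_t (complex.Im (u n t) * sin (t * x))) * \1_(`[a, b]) x)).
    by apply: eq_Rintegral => x _; exact: hatRe.
  rewrite RintegralD//.
  have [ire iim] := LpR1_integrable (u1 n); rewrite !trig_integral_itvE//;
    do ?[exact: cos_norm_le1|exact: sin_norm_le1].
- have lhs : \int[mu]_x (complex.Im (fourierL1 (u n) x) * \1_(`[a, b]) x)
      @[n --> \oo] --> \int[mu]_x (complex.Im (g x) * \1_(`[a, b]) x).
    apply: (Lnorm2_pairing_cvg _ _ _ _ K2 _ _ ug).
    + by move=> n; exact: (mhat n).2.
    + exact: mg.2.
    + by move=> n x; rewrite -Im_sub; exact: le_Im_normc.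
    + by move=> n; exact: mB.
    + move=> n; have := integrableB measurableT (iic n) (irs n).
      by congr integrable; apply/funext => x /=; rewrite hatIm EFinB.
    + by apply: integrable_Lfun2M => //; exact: LpR2_Im.
  have rhs := cvgB (ImP _ C2) (ReP _ S2).
  apply: (cvg_unique (@norm_hausdorff _ R) lhs).
  have -> : (fun n => \int[mu]_x (complex.Im (fourierL1 (u n) x) * \1_(`[a, b]) x)) =
      (fun n => \int[mu]_t (complex.Im (u n t) * itv_transform cos a b t) -
        \int[mu]_t (complex.Re (u n t) * itv_transform sin a b t)); last exact: rhs.
  apply/funext => n; transitivity (\int[mu]_x (
      (\int[mu]_t (complex.Im (u n t) * cos (t * x))) * \1_(`[a, b]) x -
      (\int[mu]_t (complex.Re (u n t) * sin (t * x))) * \1_(`[a, b]) x)).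
    by apply: eq_Rintegral => x _; exact: hatIm.
  rewrite RintegralB//.
  have [ire iim] := LpR1_integrable (u1 n); rewrite !trig_integral_itvE//;
    do ?[exact: cos_norm_le1|exact: sin_norm_le1].
Qed.

End weak_fourier.

(** * Uniqueness and dilation of the Fourier transform *)

Section fourier_uniqueness.
Context {R : realType}.
Local Notation mu := (@lebesgue_measure R).
Implicit Types (f : R -> R) (psi g : R -> R[i]) (a b : R).

(** A primitive of [f] is locally constant, and almost everywhere its derivative
is [f]. *)
Lemma itv_integral0_ae f : f \in Lfun mu 2%:E ->
  (forall a b, a < b -> \int[mu]_x (f x * \1_(`[a, b]) x) = 0) ->
  {ae mu, forall x, f x = 0}.
Proof.
move=> f2 f0.
suff : {ae mu, forall x, forall n : nat, - n%:R < x < n%:R -> f x = 0}.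
  apply: filterS => x fx.
  by apply: (fx (Num.bound `|x|)); rewrite -ltr_norml archi_boundP.
apply: ae_foralln => n.
pose fn x := f x * \1_(`[- n%:R, n%:R]) x.
have ifn : mu.-integrable setT (EFin \o fn).
  exact: integrable_Lfun2M f2 (indic_itv_Lfun2 _ _).
have ifny y : mu.-integrable `]-oo, y] (EFin \o fn).
  by apply: (integrableS _ _ _ ifn).
have lfn : locally_integrable setT fn.
  by apply: open_integrable_locally => //; exact: openT.
have := FTC1Ny ifny lfn; apply: filterS => x [_ dF] /andP[nx xn].
have <- : fn x = f x.
  by rewrite /fn indicE mem_set ?mulr1//= in_itv/= !ltW.
rewrite -dF derive1E.
rewrite (near_eq_derive (g := cst 0))//.
  by rewrite derive_cst.
near=> y.
rewrite /cst -(f0 (- n%:R) y); last by near: y; exact: lt_nbhsr.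
rewrite Rintegral_mkcond; apply: eq_Rintegral => t _.
rewrite patchE /fn !indicE.
have yn : y <= n%:R by apply: ltW; near: y; exact: lt_nbhsl.
case: ifPn => [|]; rewrite ?inE ?notin_setE/= in_itv/=.
  move=> ty; congr (_ * _); congr (nat_of_bool _)%:R.
  by apply/idP/idP; rewrite !inE/= !in_itv/= => /andP[-> _]; rewrite ?ty// (le_trans ty).
by move=> ty; rewrite memNset ?mulr0//= in_itv/= => /andP[_ /ty].
Unshelve. all: by end_near. Qed.

Lemma Rintegral_scale (a : R) f : 0 < a -> mu.-integrable setT (EFin \o f) ->
  \int[mu]_x f x = a * \int[mu]_x f (a * x).
Proof.
move=> a0 fi; have := integral_affine 0 a0 measurableT fi.
have := integrable_affine 0 a0 measurableT fi.
rewrite preimage_setT => fai.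
rewrite /Rintegral => ->; rewrite fineM//; last exact: integrable_fin_num.
by congr (_ * fine _); apply: eq_integral => x _; rewrite /affine/= addr0.
Qed.

Lemma scale_itvE (a x b c : R) : 0 < a ->
  (a * x \in `[a * b, a * c]) = (x \in `[b, c]).
Proof. by move=> a0; rewrite !in_itv/= !ler_pM2l. Qed.

Lemma itv_transform_scale (c : R -> R) (s a b t : R) : 0 < s -> a < b ->
  continuous c -> (forall y, `|c y| <= 1) ->
  itv_transform c (s * a) (s * b) t = s * itv_transform c a b (s * t).
Proof.
move=> s0 ab cc c1; rewrite /itv_transform.
rewrite Rintegral_mkcond [in RHS]Rintegral_mkcond.
have ct : continuous (fun x : R => c (t * x)).
  move=> x; apply: continuous_comp; last exact: cc.
  exact: mulrl_continuous.
rewrite (Rintegral_scale s0).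
  congr (_ * _); apply: eq_Rintegral => x _; rewrite !patchE !mem_setE.
  by rewrite scale_itvE// mulrA [t * s]mulrC.
rewrite -restrict_EFin; apply/integrable_restrict => //=; rewrite setTI.
apply: measurable_bounded_integrable => //.
- by rewrite /= lebesgue_measure_itv/= lte_fin ltr_pM2l// ab -EFinD ltry.
- by apply: measurable_funTS; exact: continuous_measurable_fun.
- by exists 1; split => // M M1 x _; exact: le_trans (c1 _) (ltW M1).
Qed.

Lemma Lfun2_scale f (a : R) : 0 < a -> f \in Lfun mu 2%:E ->
  (fun x => f (a * x)) \in Lfun mu 2%:E.
Proof.
move=> a0 f2.
have mf : measurable_fun setT f by move: f2; rewrite inE => /andP[]; rewrite inE.
apply: Lfun2P; first by apply: measurableT_comp => //; exact: measurable_funM.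
have := integrable_affine 0 a0 measurableT (Lfun2_integrable_sqr f2).
rewrite preimage_setT => /(integrable_lty measurableT).
by rewrite /affine/=; under eq_integral do rewrite addr0.
Qed.

Lemma Lfun2B f h : f \in Lfun mu 2%:E -> h \in Lfun mu 2%:E ->
  (fun x => f x - h x) \in Lfun mu 2%:E.
Proof.
move=> f2 h2.
have mf : measurable_fun setT f by move: f2; rewrite inE => /andP[]; rewrite inE.
have mh : measurable_fun setT h by move: h2; rewrite inE => /andP[]; rewrite inE.
apply: Lfun2P; first exact: measurable_funB.
have i := integrableD measurableT
  (integrableZl measurableT 2 (Lfun2_integrable_sqr f2))
  (integrableZl measurableT 2 (Lfun2_integrable_sqr h2)).
apply: le_lt_trans (integrable_lty measurableT i).
apply: ge0_le_integral => //.
- by move=> x _; rewrite lee_fin sqr_ge0.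
- by apply/measurable_EFinP; apply: measurable_funX; exact: measurable_funB.
- exact: measurable_int i.
- by move=> x _; rewrite /= -!EFinM -EFinD lee_fin; have := sqr_ge0 (f x + h x); nra.
Qed.

(** The change of variable that moves the dilation from [f] to the kernel. *)
Lemma dilated_pairing f (K L : R -> R) (a : R) : 0 < a ->
  f \in Lfun mu 2%:E -> L \in Lfun mu 2%:E ->
  (forall t, L t = a * K (a * t)) ->
  \int[mu]_t (f (t / a) * K t) = \int[mu]_t (f t * L t).
Proof.
move=> a0 f2 L2 LK.
have a0' : 0 < a^-1 by rewrite invr_gt0.
rewrite [RHS](Rintegral_scale a0'); last exact: integrable_Lfun2M.
rewrite -RintegralZl//; last first.
  apply: integrable_Lfun2M; first exact: Lfun2_scale.
  exact: Lfun2_scale.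
apply: eq_Rintegral => t _; rewrite LK mulVKf ?gt_eqF// [t / a]mulrC.
by rewrite mulrCA [_ * (_ * K _)]mulKf ?gt_eqF.
Qed.

(** On an interval, both sides integrate to the pairing of [psi] with the
transform of the indicator of the dilated interval. *)
Lemma fourier_dilation (N : nat) psi g G : (0 < N)%N ->
  is_fourier psi g -> is_fourier (dilation N psi) G ->
  {ae mu, forall x, G x = real_complex R (Num.sqrt N%:R) * g (N%:R * x)}.
Proof.
move=> N0 Fg FG.
have NR0 : 0 < N%:R :> R by rewrite ltr0n.
set r := Num.sqrt N%:R; have r0 : 0 < r by rewrite sqrtr_gt0.
have rr : r * r = N%:R by rewrite -expr2 sqr_sqrtr// ltW.
have psi2 : LpR 2%:E psi by case: Fg.
have g2 : LpR 2%:E g by case: Fg.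
have G2 : LpR 2%:E G by case: FG.
have cc := @continuous_cos R; have cs := @continuous_sin R.
have RedE t : complex.Re (dilation N psi t) = r^-1 * complex.Re (psi (t / N%:R)).
  by rewrite /dilation /= -/r; case: (psi _) => ? ? /=; rewrite mul0r subr0.
have ImdE t : complex.Im (dilation N psi t) = r^-1 * complex.Im (psi (t / N%:R)).
  by rewrite /dilation /= -/r; case: (psi _) => ? ? /=; rewrite mul0r addr0.
have pair p (c : R -> R) a b : a < b -> continuous c -> (forall y, `|c y| <= 1) ->
    itv_transform c a b \in Lfun mu 2%:E ->
    itv_transform c (N%:R * a) (N%:R * b) \in Lfun mu 2%:E ->
    p \in Lfun mu 2%:E ->
    \int[mu]_t (r^-1 * p (t / N%:R) * itv_transform c a b t) =
    r^-1 * \int[mu]_t (p t * itv_transform c (N%:R * a) (N%:R * b) t).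
  move=> ab cc' c1 K2 L2 p2.
  rewrite -(dilated_pairing (K := itv_transform c a b) NR0 p2 L2); last first.
    by move=> t; exact: itv_transform_scale.
  rewrite -RintegralZl//; first by apply: eq_Rintegral => t _; rewrite mulrA.
  apply: integrable_Lfun2M => //.
  have NRV : 0 < N%:R^-1 :> R by rewrite invr_gt0.
  by have := Lfun2_scale NRV p2; under eq_fun do rewrite mulrC.
have indic p a b : p \in Lfun mu 2%:E ->
    \int[mu]_x (p x * \1_(`[N%:R * a, N%:R * b]) x) =
    N%:R * \int[mu]_x (p (N%:R * x) * \1_(`[a, b]) x).
  move=> p2; rewrite (Rintegral_scale NR0); last first.
    exact: integrable_Lfun2M p2 (indic_itv_Lfun2 _ _).
  congr (_ * _); apply: eq_Rintegral => x _.
  by rewrite !indicE !mem_setE scale_itvE.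
have Nab a b : a < b -> N%:R * a < N%:R * b by rewrite ltr_pM2l.
have rN : r^-1 * N%:R = r by rewrite -rr mulKf// gt_eqF.
have EG a b : a < b ->
    \int[mu]_x (complex.Re (G x) * \1_(`[a, b]) x) =
      r * \int[mu]_x (complex.Re (g (N%:R * x)) * \1_(`[a, b]) x) /\
    \int[mu]_x (complex.Im (G x) * \1_(`[a, b]) x) =
      r * \int[mu]_x (complex.Im (g (N%:R * x)) * \1_(`[a, b]) x).
  move=> ab; have [-> ->] := is_fourier_itv ab FG.
  have [gre gim] := is_fourier_itv (Nab _ _ ab) Fg.
  have Re2 := LpR2_Re psi2; have Im2 := LpR2_Im psi2.
  have [Kc Ks] := (cos_transform_Lfun2 ab, sin_transform_Lfun2 ab).
  have [Lc Ls] := (cos_transform_Lfun2 (Nab _ _ ab), sin_transform_Lfun2 (Nab _ _ ab)).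
  have dRe (K : R -> R) : \int[mu]_t (complex.Re (dilation N psi t) * K t) =
      \int[mu]_t (r^-1 * complex.Re (psi (t / N%:R)) * K t).
    by apply: eq_Rintegral => t _; rewrite RedE.
  have dIm (K : R -> R) : \int[mu]_t (complex.Im (dilation N psi t) * K t) =
      \int[mu]_t (r^-1 * complex.Im (psi (t / N%:R)) * K t).
    by apply: eq_Rintegral => t _; rewrite ImdE.
  rewrite !dRe !dIm.
  have /= -> := pair _ _ _ _ ab cc (@cos_norm_le1 R) Kc Lc Re2.
  have /= -> := pair _ _ _ _ ab cc (@cos_norm_le1 R) Kc Lc Im2.
  have /= -> := pair _ _ _ _ ab cs (@sin_norm_le1 R) Ks Ls Re2.
  have /= -> := pair _ _ _ _ ab cs (@sin_norm_le1 R) Ks Ls Im2.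
  rewrite -mulrDr -mulrBr -gre -gim.
  have /= -> := indic _ a b (LpR2_Re g2); have /= -> := indic _ a b (LpR2_Im g2).
  by rewrite !mulrA rN.
have zero p q : p \in Lfun mu 2%:E -> q \in Lfun mu 2%:E ->
    (forall a b, a < b -> \int[mu]_x (p x * \1_(`[a, b]) x) =
      r * \int[mu]_x (q (N%:R * x) * \1_(`[a, b]) x)) ->
    {ae mu, forall x, p x = r * q (N%:R * x)}.
  move=> p2 q2 pq.
  have q2' := Lfun2_scale NR0 q2.
  have rq2 : (fun x => r * q (N%:R * x)) \in Lfun mu 2%:E.
    rewrite (_ : (fun x => _) = r \o* (fun x => q (N%:R * x))).
      by apply: Lfun_scale => //; rewrite ler1n.
    by apply/funext => x; rewrite /= mulrC.
  have : (fun x => p x - r * q (N%:R * x)) \in Lfun mu 2%:E.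
    exact: Lfun2B.
  move=> /itv_integral0_ae z; have /z : forall a b, a < b ->
      \int[mu]_x ((p x - r * q (N%:R * x)) * \1_(`[a, b]) x) = 0.
    move=> a b ab; have i2 := indic_itv_Lfun2 a b.
    under eq_Rintegral do rewrite mulrBl -mulrA.
    rewrite RintegralB//; last 2 first.
    - exact: integrable_Lfun2M.
    - under eq_fun do rewrite mulrA; exact: integrable_Lfun2M.
    by rewrite pq// RintegralZl ?subrr//; exact: integrable_Lfun2M.
  by apply: filterS => x /eqP; rewrite subr_eq0 => /eqP.
have aRe := zero _ _ (LpR2_Re G2) (LpR2_Re g2) (fun a b ab => (EG a b ab).1).
have aIm := zero _ _ (LpR2_Im G2) (LpR2_Im g2) (fun a b ab => (EG a b ab).2).
apply: filterS2 aRe aIm => x.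
case: (G x) (g _) => u v [u' v'] /= -> ->.
by apply/eqP; rewrite eq_complex/= !mul0r subr0 addr0 !eqxx.
Qed.

Lemma is_fourier_unique psi g G :
  is_fourier psi g -> is_fourier psi G -> {ae mu, forall x, G x = g x}.
Proof.
move=> Fg FG; have E : dilation 1 psi = psi.
  by apply/funext => x; rewrite /dilation !mulr1n sqrtr1 !invr1 rmorph1 mul1r mulr1.
have := @fourier_dilation 1 psi g G isT Fg; rewrite E => /(_ FG).
by apply: filterS => x ->; rewrite !mulr1n sqrtr1 rmorph1 !mul1r.
Qed.

End fourier_uniqueness.

(** * Periodization of nonnegative functions *)

Section int_enumeration.
Context {R : realType}.

(** The enumeration 0, -1, 1, -2, 2, ... of the integers. *)
Definition int_enum (n : nat) : int := if odd n then - (n./2.+1)%:Z else (n./2)%:Z.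

Lemma int_enum_inj : injective int_enum.
Proof. by move=> m n; rewrite /int_enum; case: ifP => ?; case: ifP => ?; lia. Qed.

Lemma int_enum_surj k : exists n, int_enum n = k.
Proof.
case: k => n; rewrite /int_enum.
  by exists n.*2; rewrite odd_double doubleK.
by exists n.*2.+1; rewrite /= odd_double/= uphalf_double NegzE.
Qed.

Definition int_segment (n : nat) : {fset int} :=
  seq_fset tt [seq int_enum i | i <- iota 0 n].

Lemma int_segment_sum {V : zmodType} (x : int -> V) n :
  \sum_(k <- int_segment n) x k = \sum_(i < n) x (int_enum i).
Proof.
rewrite (perm_big [seq int_enum i | i <- iota 0 n])/=.
  by rewrite big_map -(subn0 n) -/(index_iota 0 n) big_mkord subn0.
apply: uniq_perm; first exact: sort_keys_uniq.
  by rewrite map_inj_uniq ?iota_uniq//; exact: int_enum_inj.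
by move=> k; rewrite sort_keysE.
Qed.

Lemma int_segment_exhaust (A : {fset int}) :
  exists m, forall n, (m <= n)%N -> (A `<=` int_segment n)%fset.
Proof.
have /choice[r rP] := int_enum_surj.
exists (\max_(k <- A) (r k).+1)%N => n mn; apply/fsubsetP => k kA.
rewrite seq_fsetE; apply/mapP; exists (r k); last by rewrite rP.
by rewrite mem_iota/= add0n; apply: leq_trans mn; exact: leq_bigmax_seq.
Qed.

Lemma int_segment_cofinal : int_segment n @[n --> \oo] --> totally.
Proof.
move=> P [A _ AP]; have [m Am] := int_segment_exhaust A.
by exists m => // n /= mn; apply: AP; exact: Am.
Qed.

Lemma sum_le_int_segment (x : int -> R) (A : {fset int}) :
  (forall k, 0 <= x k) ->
  exists n, \sum_(k <- A) x k <= \sum_(i < n) x (int_enum i).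
Proof.
move=> x0; have [n An] := int_segment_exhaust A; exists n.
rewrite -int_segment_sum (big_fsetID _ (mem A) (int_segment n))/=.
rewrite (_ : [fset k in int_segment n | k \in A]%fset = A).
  by rewrite lerDl; apply: sumr_ge0.
apply/fsetP => k; rewrite !inE/= andbC; apply: andb_idr => kA.
exact: (fsubsetP (An n (leqnn _))).
Qed.

End int_enumeration.

Section periodization.
Context {R : realType}.
Local Notation mu := (@lebesgue_measure R).
Implicit Types (g : R -> R) (F : R -> R[i]).

Definition translates {V : Type} (g : R -> V) (w : R) (k : int) : V :=
  g (w + 2 * k%:~R * pi).

(** With extended real values, the periodization is measurable without any prior
convergence. *)
Definition ePer g (w : R) : \bar R := (\sum_(n <oo) (translates g w (int_enum n))%:E)%E.

Lemma translates_affine {V : Type} (g : R -> V) (k : int) :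
  (fun w => translates g w k) = g \o affine 1 (2 * k%:~R * pi).
Proof. by apply/funext => w; rewrite /translates /affine/= mul1r. Qed.

Lemma measurable_translates g k : measurable_fun setT g ->
  measurable_fun setT (fun w => translates g w k).
Proof.
by move=> mg; rewrite translates_affine; apply: measurableT_comp => //; exact: measurable_affine.
Qed.

Section nonneg.
Variable g : R -> R.
Hypotheses (mg : measurable_fun setT g) (g0 : forall x, 0 <= g x).

Let t0 w k : 0 <= translates g w k. Proof. exact: g0. Qed.

Lemma measurable_ePer : measurable_fun setT (ePer g).
Proof.
apply: ge0_emeasurable_sum => [n w _ _|n _]; first by rewrite lee_fin.
by apply/measurable_EFinP; exact: measurable_translates.
Qed.

Lemma ePer_ge0 w : (0 <= ePer g w)%E.
Proof. by apply: nneseries_ge0 => n _ _; rewrite lee_fin. Qed.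

Lemma sum_translates_le_ePer w (A : {fset int}) :
  ((\sum_(k <- A) translates g w k)%:E <= ePer g w)%E.
Proof.
have [n An] := sum_le_int_segment A (t0 w).
apply: (@le_trans _ _ (\sum_(i < n) translates g w (int_enum i))%:E).
  by rewrite lee_fin.
rewrite -sumEFin -(big_mkord xpredT (fun i => (translates g w (int_enum i))%:E)).
by apply: nneseries_lim_ge => i _ _; rewrite lee_fin.
Qed.

Lemma ePer_le_bound w (M : R) :
  (forall A : {fset int}, \sum_(k <- A) translates g w k <= M) ->
  (ePer g w <= M%:E)%E.
Proof.
move=> gM; apply: lime_le.
  by apply: is_cvg_nneseries => i _ _; rewrite lee_fin.
near=> n; rewrite big_mkord sumEFin lee_fin -(int_segment_sum (translates g w)).
exact: gM.
Unshelve. all: by end_near. Qed.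

Lemma ePer_fin_has_sum w : (ePer g w < +oo)%E ->
  has_sum (translates g w) (fine (ePer g w)).
Proof.
move=> goo.
have gfin : ePer g w \is a fin_num by rewrite ge0_fin_numE ?ePer_ge0.
have [l gl] : exists l, has_sum (translates g w) l.
  apply: (@has_sum_nneg_exists _ _ _ (fine (ePer g w))) => // A.
  by rewrite -lee_fin fineK//; exact: sum_translates_le_ePer.
suff -> : fine (ePer g w) = l by [].
apply/eqP; rewrite eq_le; apply/andP; split.
  rewrite -lee_fin fineK//; apply: ePer_le_bound.
  exact: has_sum_ge_partial.
apply: has_sum_le_bound gl _ => A; rewrite -lee_fin fineK//.
exact: sum_translates_le_ePer.
Qed.

(** The translates of the fundamental domain are disjoint. *)
Lemma integral_ePer_le : (\int[mu]_(w in circle_dom) ePer g w <= \int[mu]_w (g w)%:E)%E.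
Proof.
have p0 : 0 < 2 * pi :> R by rewrite mulr_gt0// pi_gt0.
have mc : measurable (circle_dom : set R) by exact: measurable_itv.
rewrite integral_nneseries//; last 2 first.
- move=> n; apply/measurable_EFinP; apply: measurable_funTS.
  exact: measurable_translates.
- by move=> n w _; rewrite lee_fin.
pose D (n : nat) : set R := affine 1 (- (2 * (int_enum n)%:~R * pi)) @^-1` circle_dom.
have mD n : measurable (D n) by exact: measurable_affine_preimage.
have DE n : (\int[mu]_(w in circle_dom) (translates g w (int_enum n))%:E =
    \int[mu]_(w in D n) (g w)%:E)%E.
  rewrite [RHS](ge0_integral_affine (2 * (int_enum n)%:~R * pi) ltr01)//; last 2 first.
  - by apply/measurable_EFinP; exact: measurable_funTS.
  - by move=> x _; rewrite lee_fin.
  rewrite mul1e (_ : _ @^-1` D n = circle_dom); last first.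
    by apply/seteqP; split => x; rewrite /D /affine/= !mul1r addrK.
  by apply: eq_integral => x _; rewrite /translates /affine mul1r.
under eq_eseriesr do rewrite DE.
rewrite -ge0_integral_bigcup//.
- apply: ge0_subset_integral => //; first by apply: bigcup_measurable => n _; exact: mD.
    exact/measurable_EFinP.
  by move=> x _; rewrite lee_fin.
- by apply/measurable_EFinP; exact: measurable_funTS.
- by move=> x _; rewrite lee_fin.
apply/trivIsetP => m n _ _ mn; rewrite -subset0 => x [].
rewrite /D /affine/= /circle_dom/= !in_itv/= !mul1r => /andP[m1 m2] /andP[n1 n2].
have mn' : int_enum m != int_enum n by apply: contra_neq mn; exact: int_enum_inj.
have pp := pi_gt0 R.
have [lt|lt] : int_enum m + 1 <= int_enum n \/ int_enum n + 1 <= int_enum m by lia.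
  have : (int_enum m)%:~R + 1 <= (int_enum n)%:~R :> R by rewrite -(intrD _ _ 1) ler_int.
  nra.
have : (int_enum n)%:~R + 1 <= (int_enum m)%:~R :> R by rewrite -(intrD _ _ 1) ler_int.
nra.
Qed.

Lemma ePer_fin_translate w : (ePer g w < +oo)%E ->
  forall j : int, (ePer g (w + 2 * j%:~R * pi) < +oo)%E.
Proof.
move=> fin j.
have gfin : ePer g w \is a fin_num by rewrite ge0_fin_numE ?ePer_ge0.
apply: (@le_lt_trans _ _ (fine (ePer g w))%:E); last by rewrite ltry.
apply: ePer_le_bound => A.
rewrite -lee_fin fineK//; apply: le_trans (sum_translates_le_ePer _ [fset (j + k)%R | k in A]%fset).
rewrite lee_fin big_imfset/=; last by move=> ? ? _ _ /addrI.
apply: ler_sum => k _.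
suff -> : translates g (w + 2 * j%:~R * pi) k = translates g w (j + k) by [].
by rewrite /translates intrD; congr g; ring.
Qed.

Lemma ePer_fin_ae : (\int[mu]_w (g w)%:E < +oo)%E ->
  {ae mu, forall w, (ePer g w < +oo)%E}.
Proof.
move=> goo; apply: ae_periodic.
  move=> w; split => /ePer_fin_translate fin.
    by have := fin (- 1); rewrite -addrA (_ : 2 * pi + _ = 0) ?addr0//; ring.
  by have := fin 1; rewrite mulr1.
have mc : measurable (circle_dom : set R) by exact: measurable_itv.
have ig : mu.-integrable circle_dom (ePer g).
  apply/integrableP; split; first exact: measurable_funTS measurable_ePer.
  under eq_integral => w _ do rewrite gee0_abs ?ePer_ge0//.
  exact: le_lt_trans integral_ePer_le goo.
have : {ae mu, forall x, circle_dom x -> ePer g x \is a fin_num}.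
  exact: integrable_ae.
apply: filterS => w fin /fin.
by rewrite ge0_fin_numE ?ePer_ge0.
Qed.

End nonneg.

End periodization.

(** * Periodization of complex functions *)

Section complex_periodization.
Context {R : realType}.
Local Notation mu := (@lebesgue_measure R).
Implicit Types (F : R -> R[i]).

Definition cPer F : R -> R[i] := Per (F : R -> R[i]^o).

Lemma cPer_periodic F : periodic2pi (cPer F).
Proof.
move=> w; rewrite /cPer /Per.
rewrite -[RHS](sum_shift (fun k => F (w + 2 * k%:~R * pi) : R[i]^o) 1).
apply: (congr1 (@summability.sum _ _ R[i]^o)).
by apply/funext => k; congr F; rewrite intrD; ring.
Qed.

Lemma has_sum_cPer F w (a b : R) :
  has_sum (translates (fun x => complex.Re (F x)) w) a ->
  has_sum (translates (fun x => complex.Im (F x)) w) b ->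
  cPer F w = Complex a b.
Proof. exact: complex_sumE. Qed.

Lemma cPer_has_sum F w : (ePer (fun x => normc (F x)) w < +oo)%E ->
  [/\ has_sum (translates (fun x => complex.Re (F x)) w) (complex.Re (cPer F w)),
      has_sum (translates (fun x => complex.Im (F x)) w) (complex.Im (cPer F w)),
      `|complex.Re (cPer F w)| <= fine (ePer (fun x => normc (F x)) w) &
      `|complex.Im (cPer F w)| <= fine (ePer (fun x => normc (F x)) w)].
Proof.
move=> /(ePer_fin_has_sum (fun x => normc_ge0 (F x))) hs.
have [a ha la] := has_sum_dominated (fun k => le_Re_normc (F (w + 2 * k%:~R * pi))) hs.
have [b hb lb] := has_sum_dominated (fun k => le_Im_normc (F (w + 2 * k%:~R * pi))) hs.
by rewrite (has_sum_cPer ha hb).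
Qed.

Lemma cPer_infinite F w : ~~ (ePer (fun x => normc (F x)) w < +oo)%E ->
  cPer F w = 0.
Proof.
move=> inf; apply: complex_sum_unbounded => -[M FM]; move/negP: inf; apply.
apply: le_lt_trans (ltry M); apply: ePer_le_bound => [x|A]; first exact: normc_ge0.
exact: FM.
Qed.

Lemma normc_cPer_le F w :
  ((normc (cPer F w))%:E <= 2%:E * ePer (fun x => normc (F x)) w)%E.
Proof.
have n0 x := normc_ge0 (F x).
have [fin|inf] := boolP (ePer (fun x => normc (F x)) w < +oo)%E; last first.
  rewrite (cPer_infinite inf) Normc.normc0 mule_ge0//; exact: ePer_ge0.
have [_ _ re im] := cPer_has_sum fin.
rewrite -[X in (_ * X)%E]fineK ?ge0_fin_numE ?ePer_ge0// -EFinM lee_fin.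
by apply: le_trans (normc_le_ReIm _) _; lra.
Qed.

Section measurability.
Variable F : R -> R[i].
Hypothesis mF : cmeasurable F.

Let mn : measurable_fun setT (fun x => normc (F x)). Proof. exact: measurable_normc. Qed.
Let E : set R := [set w | (ePer (fun x => normc (F x)) w < +oo)%E].

Let mE : measurable E.
Proof.
have := emeasurable_fun_infty_o measurableT (measurable_ePer mn (fun x => normc_ge0 (F x))) +oo%E.
by rewrite setTI.
Qed.

(** Outside the measurable set where the sum converges absolutely, the
periodization vanishes; inside, it is a limit of finite sums. *)
Lemma measurable_cPer_part (r : R[i] -> R) : r 0 = 0 ->
  measurable_fun setT (fun x => r (F x)) ->
  (forall w, E w -> has_sum (translates (fun x => r (F x)) w) (r (cPer F w))) ->
  measurable_fun setT (fun w => r (cPer F w)).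
Proof.
move=> r0 mr hr.
apply: (measurable_fun_cvg (h := fun n w =>
  (\sum_(i < n) translates (fun x => r (F x)) w (int_enum i)) * \1_E w)).
  move=> n; apply: measurable_funM; last exact: measurable_indic.
  by apply: measurable_sum => i; exact: measurable_translates.
move=> w _; rewrite indicE; have [wE|wE] := boolP (w \in E).
  under eq_fun do rewrite mulr1 -int_segment_sum.
  by apply: (has_sum_cofinal int_segment_cofinal); apply: hr; rewrite inE in wE.
rewrite cPer_infinite ?r0; last by move: wE; rewrite notin_setE => /negP.
by under eq_fun do rewrite mulr0; exact: cvg_cst.
Qed.

Lemma cmeasurable_cPer : cmeasurable (cPer F).
Proof.
split.
- by apply: measurable_cPer_part => //; [exact: mF.1|move=> w /cPer_has_sum[]].
- by apply: measurable_cPer_part => //; [exact: mF.2|move=> w /cPer_has_sum[]].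
Qed.

Lemma L1T_cPer : (\int[mu]_x (normc (F x))%:E < +oo)%E -> L1T (cPer F).
Proof.
move=> Foo; have mc := cmeasurable_cPer; have n0 x := normc_ge0 (F x).
split => //; first exact: cPer_periodic.
have mP := measurable_ePer mn n0.
apply/integrableP; split.
  by apply: measurable_funTS; apply/measurable_EFinP; exact: measurable_normc.
apply: (@le_lt_trans _ _ (\int[mu]_(w in circle_dom) (2%:E * ePer (fun x => normc (F x)) w))%E).
  apply: ge0_le_integral => //.
  - exact: measurable_itv.
  - apply: measurable_funTS; apply: measurableT_comp => //.
    by apply/measurable_EFinP; exact: measurable_normc.
  - by apply: emeasurable_funM => //; exact: measurable_funTS.
  - move=> w _; rewrite gee0_abs ?lee_fin ?normc_ge0//; exact: normc_cPer_le.
rewrite ge0_integralZl//; last 3 first.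
- exact: measurable_itv.
- exact: measurable_funTS.
- by move=> w _; exact: ePer_ge0.
by rewrite lte_mul_pinfty//; exact: le_lt_trans (integral_ePer_le mn n0) Foo.
Qed.

End measurability.

End complex_periodization.

Section cauchy_schwarz.
Context {R : realType} {I : choiceType}.

(** The quadratic polynomial in [y] with value the sum of the [(y * a i - b i) ^+ 2]
is nonnegative. *)
Lemma has_sum_cauchy_schwarz (a b : I -> R) (A B S : R) :
  has_sum (fun i => a i ^+ 2) A -> has_sum (fun i => b i ^+ 2) B ->
  has_sum (fun i => a i * b i) S -> S ^+ 2 <= A * B.
Proof.
move=> aA bB abS.
have quad (y : R) : 0 <= y ^+ 2 * A - 2 * y * S + B.
  have hs := has_sumD (has_sumB (has_sumZ (y ^+ 2) aA) (has_sumZ (2 * y) abS)) bB.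
  apply: has_sum_ge0 hs => i.
  have -> : y ^+ 2 * a i ^+ 2 - 2 * y * (a i * b i) + b i ^+ 2 = (y * a i - b i) ^+ 2.
    by ring.
  exact: sqr_ge0.
have A0 : 0 <= A by apply: has_sum_ge0 aA => i; exact: sqr_ge0.
have [A00|Apos] := eqVneq A 0.
  have [->|S0] := eqVneq S 0; first by rewrite expr0n A00 mul0r.
  have := quad ((B + 1) / (2 * S)); rewrite A00 mulr0 add0r.
  have -> : 2 * ((B + 1) / (2 * S)) * S = B + 1 by field.
  lra.
have := quad (S / A).
have -> : (S / A) ^+ 2 * A - 2 * (S / A) * S + B = (A * B - S ^+ 2) / A by field.
by rewrite pmulr_lge0 ?invr_gt0 ?lt_def ?Apos// subr_ge0.
Qed.

Lemma has_sum_mul_exists (a b : I -> R) (A B : R) :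
  has_sum (fun i => a i ^+ 2) A -> has_sum (fun i => b i ^+ 2) B ->
  exists S, has_sum (fun i => a i * b i) S.
Proof.
move=> aA bB.
have [|S hS _] := has_sum_dominated (x := fun i => a i * b i) _ (has_sumD aA bB).
  by move=> i; rewrite ler_norml; apply/andP; split; nra.
by exists S.
Qed.

End cauchy_schwarz.

(** * The cascade of a solution of the Ruelle equation *)

Section complex_modulus.
Context {R : realType}.

Lemma normc_conj (u : R[i]) : normc (conjc u) = normc u.
Proof. by case: u => x y /=; rewrite sqrrN. Qed.

Lemma normc_real (x : R) : normc (real_complex R x) = `|x|.
Proof. by rewrite /= expr0n addr0 sqrtr_sqr. Qed.

Lemma normc_natV (n : nat) : normc (n%:R^-1 : R[i]) = n%:R^-1.
Proof.
rewrite Normc.normcV; congr _^-1.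
by rewrite -(rmorph_nat (real_complex R)) normc_real ger0_norm.
Qed.

Lemma sqr_normcE (u : R[i]) : normc u ^+ 2 = complex.Re u ^+ 2 + complex.Im u ^+ 2.
Proof. by case: u => x y /=; rewrite sqr_sqrtr// addr_ge0 ?sqr_ge0. Qed.

End complex_modulus.

Section cascade.
Context {R : realType}.
Variables (N : nat) (m m' p p' h0 : R -> R[i]) (c : R).
Hypothesis hN : (2 <= N)%N.
Hypotheses (perm : periodic2pi m) (perm' : periodic2pi m') (perh0 : periodic2pi h0).
Hypothesis c0 : 0 < c.

Let a (y : R) : R := normc (p y) ^+ 2.
Let a' (y : R) : R := normc (p' y) ^+ 2.
Let h : R -> R := Per a.
Let h' : R -> R := Per a'.
Let a0 y : 0 <= a y. Proof. exact: sqr_ge0. Qed.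
Let a0' y : 0 <= a' y. Proof. exact: sqr_ge0. Qed.
Let NR0 : 0 < N%:R :> R. Proof. by rewrite ltr0n; lia. Qed.
Let NRn0 : N%:R != 0 :> R. Proof. by rewrite gt_eqF. Qed.

Definition transfer_weight (y : R) : R[i] := N%:R^-1 * (conjc (m y) * m' y).
Local Notation q := transfer_weight.

(** When [h0] is the periodization of a function that the dilation multiplies by
[q], this is the sum of that function over the translates of [x] by the multiples
of [2 pi N ^ n]. *)
Fixpoint cascade (n : nat) (x : R) : R[i] :=
  if n is n'.+1 then q (x / N%:R) * cascade n' (x / N%:R) else h0 x.

Definition local_relations (y : R) : Prop :=
  [/\ real_complex R (Num.sqrt N%:R) * p (N%:R * y) = m y * p y,
      real_complex R (Num.sqrt N%:R) * p' (N%:R * y) = m' y * p' y,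
      normc (h0 y) ^+ 2 <= c * h y * h' y,
      ruelle N m m' h0 y = h0 y &
      has_sum (translates a y) (h y) /\ has_sum (translates a' y) (h' y)].

(** The construction at [x] visits all these points. Almost every [x] is good,
because null sets are stable under the affine maps involved. *)
Definition good (x : R) : Prop := forall (n : nat) (k : int),
  local_relations ((x + 2 * k%:~R * pi) / N%:R ^+ n).

Lemma good_local x : good x -> local_relations x.
Proof. by move=> /(_ 0%N 0); rewrite mulr0 mul0r addr0 expr0 divr1. Qed.

Lemma good_translate x (j : int) : good x -> good (x + 2 * j%:~R * pi).
Proof.
move=> gx n k; have := gx n (j + k); congr (local_relations (_ / _)).
by rewrite intrD; ring.
Qed.

Lemma good_div x : good x -> good (x / N%:R).
Proof.
move=> gx n k; have := gx n.+1 (N%:Z * k); congr local_relations.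
by rewrite exprS intrM; field; rewrite expf_neq0.
Qed.

Lemma transfer_weight_periodic y (k : int) : q (y + 2 * k%:~R * pi) = q y.
Proof. by rewrite /q (periodic_int perm) (periodic_int perm'). Qed.

Lemma normc_dilated (f : R -> R[i]) (mf : R -> R[i]) y :
  real_complex R (Num.sqrt N%:R) * f (N%:R * y) = mf y * f y ->
  normc (f (N%:R * y)) ^+ 2 = N%:R^-1 * normc (mf y) ^+ 2 * normc (f y) ^+ 2.
Proof.
move=> /(congr1 (fun z => normc z ^+ 2)); rewrite !Normc.normcM !exprMn.
have -> : normc (real_complex R (Num.sqrt N%:R)) ^+ 2 = N%:R.
  rewrite /= expr0n addr0 sqrtr_sqr ger0_norm ?sqrtr_ge0//.
  by rewrite sqr_sqrtr// ltW.
by move=> E; rewrite -mulrA -E mulKf.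
Qed.

Lemma class_sum_translates (b : R -> R) x n k :
  class_sum N (translates b x) n k = class_sum N (translates b (x + 2 * k%:~R * pi)) n 0.
Proof.
rewrite /class_sum; apply: (congr1 (@summability.sum _ _ R^o)).
apply/funext => l; rewrite /translates add0r; congr b.
by rewrite intrD; ring.
Qed.

Lemma class_sum_dilated (b : R -> R) (mf : R -> R[i]) x n :
  periodic2pi mf -> (forall y, 0 <= b y) ->
  (forall k : int, b (N%:R * (x / N%:R + 2 * k%:~R * pi)) =
    N%:R^-1 * normc (mf (x / N%:R + 2 * k%:~R * pi)) ^+ 2 * b (x / N%:R + 2 * k%:~R * pi)) ->
  (exists t, has_sum (translates b (x / N%:R)) t) ->
  class_sum N (translates b x) n.+1 0 =
  N%:R^-1 * normc (mf (x / N%:R)) ^+ 2 * class_sum N (translates b (x / N%:R)) n 0.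
Proof.
move=> pmf b0 bN [t bt].
have bt' := class_sumP hN (fun k => b0 _) bt n 0.
have := has_sumZ (N%:R^-1 * normc (mf (x / N%:R)) ^+ 2) bt'.
move=> /has_sum_sum <-; rewrite /class_sum; apply: (congr1 (@summability.sum _ _ R^o)).
apply/funext => l; rewrite /translates !add0r.
rewrite -(periodic_int pmf ((N ^ n)%N%:Z * l) (x / N%:R)) -bN; congr b.
by rewrite expnS !intrM PoszM intrM -!pmulrn; field.
Qed.

(** A dilation multiplies the two class sums by the factors [N^-1 * |m|^2] and
[N^-1 * |m'|^2], whose product is [|q|^2]. *)
Lemma cascade_bound n : forall x, good x ->
  normc (cascade n x) ^+ 2 <=
  c * class_sum N (translates a x) n 0 * class_sum N (translates a' x) n 0.
Proof.
elim: n => [|n IH] x gx.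
  have [_ _ bnd _ [ha ha']] := good_local gx.
  rewrite (class_sum0 hN _ ha) ?(class_sum0 hN _ ha')//.
    by move=> k; exact: a0'.
  by move=> k; exact: a0.
have gxN := good_div gx.
have [_ _ _ _ [ha ha']] := good_local gxN.
rewrite (@class_sum_dilated a m)//; last 2 first.
- by move=> k; have [+ _ _ _ _] := good_local (good_translate k gxN); exact: normc_dilated.
- by exists (h (x / N%:R)).
rewrite (@class_sum_dilated a' m')//; last 2 first.
- by move=> k; have [_ + _ _ _] := good_local (good_translate k gxN); exact: normc_dilated.
- by exists (h' (x / N%:R)).
rewrite /= Normc.normcM exprMn.
have -> : normc (q (x / N%:R)) ^+ 2 =
    (N%:R^-1 * normc (m (x / N%:R)) ^+ 2) * (N%:R^-1 * normc (m' (x / N%:R)) ^+ 2).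
  rewrite /q !Normc.normcM !exprMn normc_conj normc_natV.
  by rewrite [X in X * _]expr2; ring.
set u := N%:R^-1 * _; set u' := N%:R^-1 * _.
have NV0 : 0 <= N%:R^-1 :> R by rewrite invr_ge0 ltW.
have u0 : 0 <= u by rewrite mulr_ge0// sqr_ge0.
have u0' : 0 <= u' by rewrite mulr_ge0// sqr_ge0.
have := ler_wpM2l (mulr_ge0 u0 u0') (IH _ gxN).
by congr (_ <= _); ring.
Qed.

(** At level 0 this is the Ruelle equation at [x]; dilations carry it to the next
levels because [q] is periodic. *)
Lemma cascade_refine n : forall x, good x ->
  cascade n x = \sum_(j < N) cascade n.+1 (x + 2 * ((N ^ n)%N%:Z * j%:Z)%:~R * pi).
Proof.
elim: n => [|n IH] x gx.
  have [_ _ _ R0 _] := good_local gx.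
  rewrite [LHS]/= -R0 /ruelle big_distrr/=; apply: eq_bigr => j _.
  by rewrite expn0 mul1r /q !mulrA.
rewrite [LHS]/= (IH _ (good_div gx)) big_distrr/=; apply: eq_bigr => j _.
have E : (x + 2 * ((N ^ n.+1)%N%:Z * j%:Z)%:~R * pi) / N%:R =
    x / N%:R + 2 * ((N ^ n)%N%:Z * j%:Z)%:~R * pi.
  by rewrite expnS !intrM PoszM intrM -!pmulrn; field.
by rewrite E transfer_weight_periodic.
Qed.

(** The limit of the cascade, given by a formula that is measurable without any
hypothesis of convergence. *)
Definition cascade_limit (x : R) : R[i] :=
  Complex (fine (limn_esup (fun n => (complex.Re (cascade n x))%:E)))
          (fine (limn_esup (fun n => (complex.Im (cascade n x))%:E))).

(** By the inequality of arithmetic and geometric means, [cascade_bound] bounds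
the cascade by the class sums of a summable family, which is what [tower_sum]
asks for; the last bound is the limit of [cascade_bound]. *)
Lemma cascade_limitP x : good x ->
  [/\ has_sum (translates (fun y => complex.Re (cascade_limit y)) x) (complex.Re (h0 x)),
      has_sum (translates (fun y => complex.Im (cascade_limit y)) x) (complex.Im (h0 x)),
      complex.Re (cascade n x) @[n --> \oo] --> complex.Re (cascade_limit x),
      complex.Im (cascade n x) @[n --> \oo] --> complex.Im (cascade_limit x) &
      normc (cascade_limit x) ^+ 2 <= c * a x * a' x].
Proof.
move=> gx; have [_ _ _ _ [ha ha']] := good_local gx.
pose C := Num.sqrt c / 2; have C0 : 0 <= C by rewrite divr_ge0// sqrtr_ge0.
pose s (k : int) := C * (translates a x k + translates a' x k).
have s0 k : 0 <= s k by rewrite mulr_ge0// addr_ge0// ?a0 ?a0'.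
have st : has_sum s (C * (h x + h' x)) by exact/has_sumZ/has_sumD.
have at0 k : 0 <= translates a x k by exact: a0.
have at0' k : 0 <= translates a' x k by exact: a0'.
have TE n k : class_sum N s n k = C *
    (class_sum N (translates a x) n k + class_sum N (translates a' x) n k).
  apply: has_sum_unique (class_sumP hN s0 st n k) _.
  exact/has_sumZ/has_sumD/(class_sumP hN at0' ha' n k)/(class_sumP hN at0 ha n k).
have bnd n k : normc (cascade n (x + 2 * k%:~R * pi)) <= class_sum N s n k.
  rewrite TE (class_sum_translates a x n k) (class_sum_translates a' x n k).
  have := cascade_bound n (good_translate k gx).
  have gk := good_local (good_translate k gx).
  have [_ _ _ _ [hak hak']] := gk.
  set A := class_sum _ _ _ _; set A' := class_sum _ _ _ _ => bound.
  have A0 : 0 <= A by apply: has_sum_ge0 (class_sumP hN (fun k => a0 _) hak n 0).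
  have A0' : 0 <= A' by apply: has_sum_ge0 (class_sumP hN (fun k => a0' _) hak' n 0).
  have AA0 : 0 <= C * (A + A') by rewrite mulr_ge0// addr_ge0.
  rewrite -(@ler_pXn2r _ 2)// ?nnegrE ?normc_ge0//; apply: le_trans bound _.
  have -> : (C * (A + A')) ^+ 2 = c * (A + A') ^+ 2 / 4.
    by rewrite /C exprMn expr_div_n sqr_sqrtr ?ltW//; field.
  rewrite -subr_ge0.
  have -> : c * (A + A') ^+ 2 / 4 - c * A * A' = c / 4 * (A - A') ^+ 2 by field.
  by rewrite mulr_ge0 ?sqr_ge0// divr_ge0// ltW.
have lim_esupE (u : nat -> R) (l : R) : u n @[n --> \oo] --> l ->
    fine (limn_esup (fun n => (u n)%:E)) = l.
  move=> ul; rewrite is_cvg_limn_esupE.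
    by rewrite (cvg_lim _ (cvg_EFin _ ul))//; exact: nearW.
  by apply/cvg_ex; exists l%:E; apply: cvg_EFin => //; exact: nearW.
have part (r : R[i] -> R) : (forall u v, r (u + v) = r u + r v) -> r 0 = 0 ->
    (forall u, `|r u| <= normc u) ->
    exists2 F : int -> R, has_sum F (r (h0 x)) &
      forall k, r (cascade n (x + 2 * k%:~R * pi)) @[n --> \oo] --> F k.
  move=> rD r0 rn.
  have rsum (I : Type) (l : seq I) (f : I -> R[i]) :
      r (\sum_(i <- l) f i) = \sum_(i <- l) r (f i).
    by elim/big_ind2 : _ => // [? ? ? ? <- <-]; exact: rD.
  apply: (tower_sum (T := class_sum N s) hN _ (class_sumS hN s0 st) _
    (class_sum0 hN s0 st) _ (class_sum_cvg hN s0 st) st).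
  - move=> n k; rewrite (cascade_refine n (good_translate k gx)) rsum.
    by apply: eq_bigr => j _; congr (r (cascade _ _)); rewrite intrD; ring.
  - by move=> k; rewrite /= (periodic_int perh0).
  - by move=> n k; apply: le_trans (rn _) (bnd n k).
have [Fr hFr cFr] := part (fun u => complex.Re u) Re_add erefl le_Re_normc.
have [Fi hFi cFi] := part (fun u => complex.Im u) Im_add erefl le_Im_normc.
have EFr : translates (fun y => complex.Re (cascade_limit y)) x = Fr.
  by apply/funext => k; exact: lim_esupE (cFr k).
have EFi : translates (fun y => complex.Im (cascade_limit y)) x = Fi.
  by apply/funext => k; exact: lim_esupE (cFi k).
have x0 : x + 2 * (0 : int)%:~R * pi = x by rewrite mulr0 mul0r addr0.
have Lr : complex.Re (cascade n x) @[n --> \oo] --> complex.Re (cascade_limit x).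
  by have := cFr 0; rewrite -EFr /translates x0.
have Li : complex.Im (cascade n x) @[n --> \oo] --> complex.Im (cascade_limit x).
  by have := cFi 0; rewrite -EFi /translates x0.
split => //; [by rewrite EFr|by rewrite EFi|].
have cA := class_sum_cvg hN at0 ha (k := 0).
have cA' := class_sum_cvg hN at0' ha' (k := 0).
rewrite /translates x0 in cA cA'.
have lhs : normc (cascade n x) ^+ 2 @[n --> \oo] --> normc (cascade_limit x) ^+ 2.
  rewrite sqr_normcE !expr2; under eq_fun do rewrite sqr_normcE !expr2.
  by apply: cvgD; apply: cvgM.
have rhs : c * class_sum N (translates a x) n 0 * class_sum N (translates a' x) n 0
    @[n --> \oo] --> c * a x * a' x.
  by apply: cvgM => //; apply: cvgM => //; exact: cvg_cst.
by apply: (ler_cvg_to lhs rhs); near=> n; exact: cascade_bound.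
Unshelve. all: by end_near. Qed.

Lemma cascade_limit_dilated x : good x -> good (N%:R * x) ->
  cascade_limit (N%:R * x) = q x * cascade_limit x.
Proof.
move=> gx gNx.
have [_ _ cr ci _] := cascade_limitP gx.
have [_ _ dr di _] := cascade_limitP gNx.
have S n : cascade n.+1 (N%:R * x) = q x * cascade n x.
  by rewrite /= [_ * x]mulrC mulfK.
have ReM (u v : R[i]) : complex.Re (u * v) =
    complex.Re u * complex.Re v - complex.Im u * complex.Im v by case: u; case: v.
have ImM (u v : R[i]) : complex.Im (u * v) =
    complex.Re u * complex.Im v + complex.Im u * complex.Re v.
  by case: u => ? ?; case: v.
have er : complex.Re (cascade n.+1 (N%:R * x)) @[n --> \oo] -->
    complex.Re (q x * cascade_limit x).
  under eq_fun do rewrite S ReM.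
  by rewrite ReM; apply: cvgB; apply: cvgM => //; exact: cvg_cst.
have ei : complex.Im (cascade n.+1 (N%:R * x)) @[n --> \oo] -->
    complex.Im (q x * cascade_limit x).
  under eq_fun do rewrite S ImM.
  by rewrite ImM; apply: cvgD; apply: cvgM => //; exact: cvg_cst.

apply/eqP; rewrite eq_complex; apply/andP; split; apply/eqP.
- have dr' : complex.Re (cascade n.+1 (N%:R * x)) @[n --> \oo] -->
      complex.Re (cascade_limit (N%:R * x)).
    by rewrite (cvg_shiftS (fun n => complex.Re (cascade n (N%:R * x)))).
  exact: (cvg_unique (@norm_hausdorff _ R) dr' er).
- have di' : complex.Im (cascade n.+1 (N%:R * x)) @[n --> \oo] -->
      complex.Im (cascade_limit (N%:R * x)).
    by rewrite (cvg_shiftS (fun n => complex.Im (cascade n (N%:R * x)))).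
  exact: (cvg_unique (@norm_hausdorff _ R) di' ei).
Qed.

End cascade.

(** * Measurable and essentially bounded complex functions *)

Section complex_functions.
Context {R : realType}.
Local Notation mu := (@lebesgue_measure R).
Implicit Types (F G f : R -> R[i]).

Lemma Re_mul (u v : R[i]) : complex.Re (u * v) =
  complex.Re u * complex.Re v - complex.Im u * complex.Im v.
Proof. by case: u; case: v. Qed.

Lemma Im_mul (u v : R[i]) : complex.Im (u * v) =
  complex.Re u * complex.Im v + complex.Im u * complex.Re v.
Proof. by case: u => ? ?; case: v. Qed.

Lemma cmeasurableM F G : cmeasurable F -> cmeasurable G ->
  cmeasurable (fun x => F x * G x).
Proof.
move=> [Fr Fi] [Gr Gi]; split.
- under eq_fun do rewrite Re_mul.
  by apply: measurable_funB; exact: measurable_funM.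
- under eq_fun do rewrite Im_mul.
  by apply: measurable_funD; exact: measurable_funM.
Qed.

Lemma cmeasurable_conj F : cmeasurable F -> cmeasurable (fun x => conjc (F x)).
Proof.
move=> [Fr Fi]; split.
- rewrite (_ : (fun x => _) = (fun x => complex.Re (F x)))//.
  by apply/funext => x /=; case: (F x).
- rewrite (_ : (fun x => _) = \- (fun x => complex.Im (F x))).
    exact: measurable_funN.
  by apply/funext => x /=; case: (F x).
Qed.

Lemma cmeasurable_cst (u : R[i]) : cmeasurable (fun _ : R => u).
Proof. by split; exact: measurable_cst. Qed.

Lemma measurable_invr : measurable_fun setT (fun x : R => x^-1).
Proof.
have m0 : measurable [set (0 : R)] by exact: measurable_set1.
rewrite -(setvU [set (0 : R)]); apply/measurable_funU => //.
  exact: measurableC.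
split; last exact: measurable_fun_set1.
apply: open_continuous_measurable_fun.
  by apply: closed_openC; apply: accessible_closed_set1; exact: hausdorff_accessible (@norm_hausdorff _ R).
by move=> x; rewrite inE/= => /eqP x0; exact: inv_continuous.
Qed.

Lemma cmeasurableV F : cmeasurable F -> cmeasurable (fun x => (F x)^-1).
Proof.
move=> [Fr Fi].
have mn : measurable_fun setT
    (fun x => (complex.Re (F x) ^+ 2 + complex.Im (F x) ^+ 2)^-1).
  apply: (measurableT_comp measurable_invr).
  by apply: measurable_funD; exact: measurable_funX.
split.
- rewrite (_ : (fun x => _) = (fun x => complex.Re (F x) *
      (complex.Re (F x) ^+ 2 + complex.Im (F x) ^+ 2)^-1)).
    exact: measurable_funM.
  by apply/funext => x; case: (F x).
- rewrite (_ : (fun x => _) = (fun x => - complex.Im (F x) *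
      (complex.Re (F x) ^+ 2 + complex.Im (F x) ^+ 2)^-1)).
    by apply: measurable_funM => //; exact: measurable_funN.
  by apply/funext => x; case: (F x) => ? ? /=; rewrite mulNr.
Qed.

Lemma cmeasurable_scale F (a : R) : cmeasurable F -> cmeasurable (fun x => F (x * a)).
Proof.
move=> [Fr Fi].
have ma : measurable_fun setT (fun x : R => x * a) by exact: measurable_funM.
by split; [exact: (measurableT_comp Fr ma)|exact: (measurableT_comp Fi ma)].
Qed.

Lemma lebesgue_setT_gt0 : (0 < mu [set: R])%E.
Proof.
have -> : [set: R] = `]-oo, +oo[%classic by rewrite set_itvNyy.
by rewrite lebesgue_measure_itv/= ?ltNyr ?ltry /=.
Qed.

Lemma LnormCyE F : LnormC +oo%E F = ess_sup mu (fun x => (normc (F x))%:E).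
Proof.
rewrite /LnormC unlock lebesgue_setT_gt0.
by congr ess_sup; apply/funext => x /=; rewrite ger0_norm ?normc_ge0.
Qed.

Lemma LpRy_bounded f : LpR +oo%E f -> exists2 M : R, 0 <= M &
  {ae mu, forall x, normc (f x) <= M}.
Proof.
move=> [mf]; rewrite LnormCyE => foo.
have := ess_sup_ge mu (fun x => (normc (f x))%:E).
have s0 : (0 <= ess_sup mu (fun x => (normc (f x))%:E))%E.
  apply: ess_sup_gee; first exact: lebesgue_setT_gt0.
  by apply: aeW => x; rewrite lee_fin normc_ge0.
have sfin : ess_sup mu (fun x => (normc (f x))%:E) \is a fin_num by rewrite ge0_fin_numE.
move=> ae_le; exists (fine (ess_sup mu (fun x => (normc (f x))%:E))).
  exact: fine_ge0.
by apply: filterS ae_le => x; rewrite -{1}(fineK sfin) lee_fin.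
Qed.

Lemma bounded_LpRy f (M : R) : cmeasurable f ->
  {ae mu, forall x, normc (f x) <= M} -> LpR +oo%E f.
Proof.
move=> mf fM; split => //; rewrite LnormCyE; apply: le_lt_trans (ltry M).
by apply/ess_supP; apply: filterS fM => x; rewrite lee_fin.
Qed.

Lemma nonsingular_ae f : periodic2pi f -> cmeasurable f -> nonsingular f ->
  {ae mu, forall x, f x != 0}.
Proof.
move=> per mf nsf; apply: ae_periodic => [x|]; first by rewrite per.
have mz : measurable [set x | f x = 0].
  have := measurable_normc mf measurableT (measurable_set1 0).
  rewrite setTI; congr measurable; apply/seteqP; split => x /=.
    exact: Normc.eq0_normc.
  by move=> ->; rewrite Normc.normc0.
have mA : measurable ([set x | f x = 0] `&` circle_dom).
  by apply: measurableI => //; exact: measurable_itv.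
exists ([set x | f x = 0] `&` circle_dom); split => //.
  by apply: nsf => // w [].
by move=> x /= /not_implyP[xc /negP]; rewrite negbK => /eqP fx; split.
Qed.

End complex_functions.

(** * Products of two refinable functions *)

Section main_directions.
Context {R : realType}.
Local Notation mu := (@lebesgue_measure R).
Variables (N : nat) (m m' p p' : R -> R[i]).
Hypothesis hN : (2 <= N)%N.
Hypotheses (perm : periodic2pi m) (perm' : periodic2pi m').
Hypotheses (mm : cmeasurable m) (mm' : cmeasurable m').
Hypotheses (p2 : LpR 2%:E p) (p2' : LpR 2%:E p').
Hypothesis relp : {ae mu, forall y,
  real_complex R (Num.sqrt N%:R) * p (N%:R * y) = m y * p y}.
Hypothesis relp' : {ae mu, forall y,
  real_complex R (Num.sqrt N%:R) * p' (N%:R * y) = m' y * p' y}.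

Let N0 : (0 < N)%N. Proof. lia. Qed.
Let NR0 : 0 < N%:R :> R. Proof. by rewrite ltr0n. Qed.
Let NRn0 : N%:R != 0 :> R. Proof. by rewrite gt_eqF. Qed.
Let mp : cmeasurable p := p2.1.
Let mp' : cmeasurable p' := p2'.1.

Let h : R -> R := Per (fun x => normc (p x) ^+ 2).
Let h' : R -> R := Per (fun x => normc (p' x) ^+ 2).
Local Notation q := (transfer_weight N m m').

Lemma cmeasurable_transfer_weight : cmeasurable q.
Proof.
apply: cmeasurableM; first exact: cmeasurable_cst.
by apply: cmeasurableM => //; exact: cmeasurable_conj.
Qed.

Lemma LpR2_Per_ae (f : R -> R[i]) : LpR 2%:E f ->
  {ae mu, forall y, has_sum (translates (fun x => normc (f x) ^+ 2) y)
    (Per (fun x => normc (f x) ^+ 2) y : R)}.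
Proof.
move=> f2.
have mf2 : measurable_fun setT (fun x => normc (f x) ^+ 2).
  by apply: measurable_funX; exact: measurable_normc f2.1.
have f0 x : 0 <= normc (f x) ^+ 2 by exact: sqr_ge0.
have foo : (\int[mu]_x (normc (f x) ^+ 2)%:E < +oo)%E.
  by rewrite LnormC2_sqr poweR_lty// f2.2.
apply: filterS (ePer_fin_ae mf2 f0 foo) => y /(ePer_fin_has_sum f0) hs.
by rewrite /Per (has_sum_sum hs).
Qed.

Definition conj_product (x : R) : R[i] := conjc (p x) * p' x.

Lemma conj_product_dilated y :
  real_complex R (Num.sqrt N%:R) * p (N%:R * y) = m y * p y ->
  real_complex R (Num.sqrt N%:R) * p' (N%:R * y) = m' y * p' y ->
  conj_product (N%:R * y) = q y * conj_product y.
Proof.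
set r := real_complex R _ => E E'.
have r0 : r != 0 by rewrite fmorph_eq0 gt_eqF// sqrtr_gt0.
have rr : r * r = N%:R.
  by rewrite /r -rmorphM -expr2 sqr_sqrtr ?(ltW NR0)// rmorph_nat.
have rc : conjc r = r by rewrite /r/= oppr0.
have NC0 : N%:R != 0 :> R[i] by rewrite pnatr_eq0; lia.
apply: (mulfI NC0); rewrite /transfer_weight !mulrA divff// mul1r -rr.
have Ec : r * conjc (p (N%:R * y)) = conjc (m y) * conjc (p y).
  by rewrite -{1}rc -!rmorphM E.
transitivity ((r * conjc (p (N%:R * y))) * (r * p' (N%:R * y))).
  by rewrite /conj_product; ring.
by rewrite Ec E' /conj_product; ring.
Qed.

(** * From solutions to scale invariant functions *)

Section forward.
Variables (h0 : R -> R[i]) (c : R).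
Hypotheses (L1h0 : L1T h0) (c0 : 0 < c).
Hypothesis ruelle_h0 : {ae mu, forall w, ruelle N m m' h0 w = h0 w}.
Hypothesis bound_h0 : {ae mu, forall w, normc (h0 w) ^+ 2 <= c * h w * h' w}.
Hypothesis nzm : {ae mu, forall y, m y != 0}.
Hypothesis nzm' : {ae mu, forall y, m' y != 0}.

Let perh0 : periodic2pi h0. Proof. by case: L1h0. Qed.
Let mh0 : cmeasurable h0. Proof. by case: L1h0. Qed.

Lemma good_ae : {ae mu, forall x, good N m m' p p' h0 c x}.
Proof.
apply: ae_dilations_translations => //.
have ha := LpR2_Per_ae p2; have ha' := LpR2_Per_ae p2'.
near=> y; split; last split; near: y; assumption.
Unshelve. all: by end_near. Qed.

Lemma cmeasurable_cascade n : cmeasurable (cascade N m m' h0 n).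
Proof.
elim: n => [//|n IH] /=; apply: cmeasurableM.
  exact: (cmeasurable_scale _ cmeasurable_transfer_weight).
exact: (cmeasurable_scale _ IH).
Qed.

Local Notation F := (cascade_limit N m m' h0).

Lemma cmeasurable_cascade_limit : cmeasurable F.
Proof.
split; apply: (measurableT_comp (fine_measurable measurableT));
  apply: measurable_fun_limn_esup => n; apply/measurable_EFinP.
- exact: (cmeasurable_cascade n).1.
- exact: (cmeasurable_cascade n).2.
Qed.

(** At the zeros of the product the value is 0, by the convention on inverses. *)
Definition quotient_symbol (x : R) : R[i] := F x / conj_product x.

Lemma cmeasurable_quotient_symbol : cmeasurable quotient_symbol.
Proof.
apply: cmeasurableM; first exact: cmeasurable_cascade_limit.
by apply: cmeasurableV; apply: cmeasurableM => //; exact: cmeasurable_conj.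
Qed.

Lemma normc_cascade_limit x : good N m m' p p' h0 c x ->
  normc (F x) ^+ 2 <= c * normc (conj_product x) ^+ 2.
Proof.
move=> gx; have [_ _ _ _ bnd] := cascade_limitP hN perm perm' perh0 c0 gx.
by rewrite /conj_product Normc.normcM normc_conj exprMn mulrA; exact: bnd.
Qed.

(** At its zeros the product forces the limit of the cascade to vanish. *)
Lemma quotient_symbolK x : good N m m' p p' h0 c x ->
  quotient_symbol x * conj_product x = F x.
Proof.
move=> /normc_cascade_limit; rewrite /quotient_symbol.
have [->|nz _] := eqVneq (conj_product x) 0; last by rewrite divfK.
rewrite Normc.normc0 expr0n mulr0 mulr0 => F0; apply/esym/Normc.eq0_normc/eqP.
by rewrite -sqrf_eq0 eq_le F0 sqr_ge0.
Qed.

Lemma quotient_symbol_bounded x : good N m m' p p' h0 c x ->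
  normc (quotient_symbol x) <= Num.sqrt c.
Proof.
move=> /normc_cascade_limit; rewrite /quotient_symbol.
have [->|nz F0] := eqVneq (conj_product x) 0.
  by rewrite invr0 mulr0 Normc.normc0 sqrtr_ge0.
have n0 : 0 < normc (conj_product x).
  rewrite lt_def normc_ge0 andbT; apply: contra nz => /eqP E.
  by apply/eqP; exact: Normc.eq0_normc.
rewrite Normc.normcM Normc.normcV ler_pdivrMr//.
rewrite -(@ler_pXn2r _ 2)// ?nnegrE ?mulr_ge0 ?normc_ge0 ?sqrtr_ge0//.
by rewrite exprMn [Num.sqrt c ^+ 2]sqr_sqrtr ?(ltW c0).
Qed.

Lemma quotient_symbol_LpRy : LpR +oo%E quotient_symbol.
Proof.
apply: (bounded_LpRy (M := Num.sqrt c)); first exact: cmeasurable_quotient_symbol.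
by apply: filterS good_ae; exact: quotient_symbol_bounded.
Qed.

(** Under the dilation both the limit of the cascade and the product are
multiplied by [q], which is nonzero almost everywhere. *)
Lemma quotient_symbol_invariant :
  {ae mu, forall x, quotient_symbol (N%:R * x) = quotient_symbol x}.
Proof.
have goodN : {ae mu, forall x, good N m m' p p' h0 c (N%:R * x)}.
  by have := ae_affine 0 NR0 good_ae; apply: filterS => x; rewrite addr0.
have goodx := good_ae.
near=> x.
have gx : good N m m' p p' h0 c x by near: x.
have gNx : good N m m' p p' h0 c (N%:R * x) by near: x.
have q0 : q x != 0.
  have mx : m x != 0 by near: x.
  have mx' : m' x != 0 by near: x.
  rewrite /transfer_weight !mulf_neq0 ?invr_eq0 ?pnatr_eq0//; first by lia.
  by rewrite fmorph_eq0.
have [R1 R1' _ _ _] := good_local gx.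
rewrite /quotient_symbol (conj_product_dilated R1 R1').
by rewrite (cascade_limit_dilated hN perm perm' perh0 c0 gx gNx) -mulf_div divff// mul1r.
Unshelve. all: by end_near. Qed.

Lemma solution_quotient_symbol : {ae mu, forall w,
  h0 w = cPer (fun x => quotient_symbol x * conj_product x) w}.
Proof.
apply: filterS good_ae => x gx.
have [hr hi _ _ _] := cascade_limitP hN perm perm' perh0 c0 gx.
have E (r : R[i] -> R) :
    translates (fun y => r (quotient_symbol y * conj_product y)) x =
    translates (fun y => r (F y)) x.
  by apply/funext => k; rewrite /translates (quotient_symbolK (good_translate k gx)).
rewrite (has_sum_cPer (a := complex.Re (h0 x)) (b := complex.Im (h0 x))).
- by case: (h0 x).
- by rewrite E.
- by rewrite E.
Qed.

End forward.

(** * From scale invariant functions to solutions *)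

Section converse.
Variable f : R -> R[i].
Hypothesis f_LpRy : LpR +oo%E f.
Hypothesis f_inv : {ae mu, forall x, f (N%:R * x) = f x}.

Let F (x : R) : R[i] := f x * conj_product x.
Let n0 x : 0 <= normc (F x). Proof. exact: normc_ge0. Qed.

Let mF : cmeasurable F.
Proof.
apply: cmeasurableM; first exact: f_LpRy.1.
by apply: cmeasurableM => //; exact: cmeasurable_conj.
Qed.

Let mnF : measurable_fun setT (fun x => normc (F x)).
Proof. exact: measurable_normc. Qed.

Lemma integral_symbol_product : (\int[mu]_x (normc (F x))%:E < +oo)%E.
Proof.
have [M M0 fM] := LpRy_bounded f_LpRy.
have ipp := integrable_Lfun2M (LpR2_normc p2) (LpR2_normc p2').
have := integrable_lty measurableT (integrableZl measurableT M ipp).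
apply: le_lt_trans; apply: ae_ge0_le_integral => //.
- by move=> x _; rewrite lee_fin normc_ge0.
- exact/measurable_EFinP.
- by move=> x _; rewrite /= -EFinM lee_fin !mulr_ge0 ?normc_ge0.
- exact: measurable_int (integrableZl measurableT M ipp).
apply: filterS fM => x fMx _; rewrite -EFinM lee_fin /F /conj_product.
rewrite !Normc.normcM normc_conj ler_wpM2r// mulr_ge0 ?normc_ge0//.
Qed.

Lemma cPer_symbol_L1T : L1T (cPer F).
Proof. exact: L1T_cPer mF integral_symbol_product. Qed.

Let F_dilated : {ae mu, forall y, F (N%:R * y) = q y * F y}.
Proof.
near=> y.
have fy : f (N%:R * y) = f y by near: y.
have R1 : real_complex R (Num.sqrt N%:R) * p (N%:R * y) = m y * p y by near: y.
have R1' : real_complex R (Num.sqrt N%:R) * p' (N%:R * y) = m' y * p' y by near: y.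
by rewrite /F fy (conj_product_dilated R1 R1') mulrCA.
Unshelve. all: by end_near. Qed.

(** The translates of [w] by multiples of [2 pi] split into [N] classes; on the
class of [j] the dilation relation turns the sum into the value at the root
[(w + 2 j pi) / N]. *)
Lemma ruelle_cPer_symbol : {ae mu, forall w, ruelle N m m' (cPer F) w = cPer F w}.
Proof.
have rel := ae_dilations_translations N0 F_dilated.
have fin := ae_dilations_translations N0 (ePer_fin_ae mnF n0 integral_symbol_product).
near=> w.
have relw : forall (n : nat) (k : int),
    F (N%:R * ((w + 2 * k%:~R * pi) / N%:R ^+ n)) =
    q ((w + 2 * k%:~R * pi) / N%:R ^+ n) * F ((w + 2 * k%:~R * pi) / N%:R ^+ n).
  by near: w.
have finw : forall (n : nat) (k : int),
    (ePer (fun x => normc (F x)) ((w + 2 * k%:~R * pi) / N%:R ^+ n) < +oo)%E.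
  by near: w.
pose v (j : 'I_N) : R := (w + 2 * j%:R * pi) / N%:R.
have class (j : 'I_N) (l : int) : translates F w (j%:Z + N%:Z * l) = q (v j) * translates F (v j) l.
  rewrite /translates.
  have -> : v j + 2 * l%:~R * pi = (w + 2 * (j%:Z + N%:Z * l)%:~R * pi) / N%:R ^+ 1.
    by rewrite /v expr1 intrD intrM -!pmulrn; field.
  have -> : q (v j) = q (v j + 2 * l%:~R * pi).
    by rewrite transfer_weight_periodic.
  have -> : v j + 2 * l%:~R * pi = (w + 2 * (j%:Z + N%:Z * l)%:~R * pi) / N%:R ^+ 1.
    by rewrite /v expr1 intrD intrM -!pmulrn; field.
  by rewrite -relw expr1 [N%:R * (_ / _)]mulrC divfK.
have val (j : 'I_N) : (ePer (fun x => normc (F x)) (v j) < +oo)%E.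
  by have := finw 1%N j%:Z; rewrite expr1 /v -pmulrn.
have part (r : R[i] -> R) (A : 'I_N -> R) :
    (forall j, has_sum (fun l => r (q (v j) * translates F (v j) l)) (A j)) ->
    has_sum (translates (fun x => r (F x)) w) (\sum_j A j).
  move=> hA; apply: has_sum_residues => // j.
  have := hA j; congr has_sum; apply/funext => l.
  by rewrite -class.
have RA (j : 'I_N) : has_sum (fun l => complex.Re (q (v j) * translates F (v j) l))
    (complex.Re (q (v j) * cPer F (v j))).
  have [hr hi _ _] := cPer_has_sum (val j).
  rewrite Re_mul; under eq_fun do rewrite Re_mul.
  exact: has_sumB (has_sumZ _ hr) (has_sumZ _ hi).
have IA (j : 'I_N) : has_sum (fun l => complex.Im (q (v j) * translates F (v j) l))
    (complex.Im (q (v j) * cPer F (v j))).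
  have [hr hi _ _] := cPer_has_sum (val j).
  rewrite Im_mul; under eq_fun do rewrite Im_mul.
  exact: has_sumD (has_sumZ _ hi) (has_sumZ _ hr).
rewrite (has_sum_cPer (part _ _ RA) (part _ _ IA)) -Re_sum -Im_sum.
set S := \sum_(j < N) _; have -> : Complex (complex.Re S) (complex.Im S) = S by case: S.
rewrite /ruelle big_distrr/=; apply: eq_bigr => j _.
by rewrite /transfer_weight /v !mulrA.
Unshelve. all: by end_near. Qed.

Lemma cPer_symbol_bound : exists2 c : R, 0 < c &
  {ae mu, forall w, normc (cPer F w) ^+ 2 <= c * h w * h' w}.
Proof.
have [M M0 fM] := LpRy_bounded f_LpRy.
(* The factor 2 comes from bounding the real and the imaginary part separately;
   the summand 1 makes the constant positive when [M] is 0. *)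
exists (2 * M ^+ 2 + 1); first by rewrite ltr_wpDl// mulr_ge0// sqr_ge0.
have fMw := ae_dilations_translations N0 fM.
have fin := ePer_fin_ae mnF n0 integral_symbol_product.
have ha := LpR2_Per_ae p2; have ha' := LpR2_Per_ae p2'.
near=> w.
have fMk : forall (n : nat) (k : int), normc (f ((w + 2 * k%:~R * pi) / N%:R ^+ n)) <= M.
  by near: w.
have finw : (ePer (fun x => normc (F x)) w < +oo)%E by near: w.
have haw : has_sum (translates (fun x => normc (p x) ^+ 2) w) (h w) by near: w.
have haw' : has_sum (translates (fun x => normc (p' x) ^+ 2) w) (h' w) by near: w.
have [S hS] := has_sum_mul_exists haw haw'.
have CS := has_sum_cauchy_schwarz haw haw' hS.
have [_ _ re im] := cPer_has_sum finw.
set E := fine _ in re im.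
have hE : has_sum (translates (fun x => normc (F x)) w) E := ePer_fin_has_sum n0 finw.
have EMS : E <= M * S.
  rewrite -subr_ge0; apply: has_sum_ge0 (has_sumB (has_sumZ M hS) hE) => k.
  rewrite subr_ge0 /translates /F /conj_product !Normc.normcM normc_conj.
  apply: ler_wpM2r; first by rewrite mulr_ge0 ?normc_ge0.
  by have := fMk 0%N k; rewrite expr0 divr1.
have E0 : 0 <= E by apply: has_sum_ge0 hE => k; exact: n0.
have hh0 : 0 <= h w * h' w.
  by apply: mulr_ge0; [apply: has_sum_ge0 haw|apply: has_sum_ge0 haw'] => k; exact: sqr_ge0.
have E2 : E ^+ 2 <= M ^+ 2 * (h w * h' w).
  apply: (@le_trans _ _ ((M * S) ^+ 2)); first by rewrite lerXn2r ?nnegrE// (le_trans E0).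
  by rewrite exprMn ler_wpM2l// sqr_ge0.
have re2 : complex.Re (cPer F w) ^+ 2 <= E ^+ 2.
  by rewrite -[leLHS]real_normK ?num_real// lerXn2r ?nnegrE.
have im2 : complex.Im (cPer F w) ^+ 2 <= E ^+ 2.
  by rewrite -[leLHS]real_normK ?num_real// lerXn2r ?nnegrE.
by rewrite sqr_normcE -mulrA mulrDl mul1r; nra.
Unshelve. all: by end_near. Qed.

End converse.

End main_directions.

(** * Solutions of the Ruelle equation and scale invariant functions *)

Unset Implicit Arguments.
Set Strict Implicit.
Set Printing Implicit Defensive.

Theorem corollary4p2 (R : realType) (N : nat) (hN : (2 <= N)%N)
    (m0 m0' : R -> R[i])
    (hm0 : LinftyT m0) (hm0' : LinftyT m0')
    (nsm0 : nonsingular m0) (nsm0' : nonsingular m0')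
    (phi phi' : R -> R[i])
    (cphi : cyclic_vector N phi) (cphi' : cyclic_vector N phi')
    (Uphi : is_pi m0 phi (dilation N phi))
    (Uphi' : is_pi m0' phi' (dilation N phi'))
    (phihat phihat' : R -> R[i])
    (Fphi : is_fourier phi phihat) (Fphi' : is_fourier phi' phihat') :
  let mu := @lebesgue_measure R in
  let h : R -> R := Per (fun x => normc (phihat x) ^+ 2) in
  let h' : R -> R := Per (fun x => normc (phihat' x) ^+ 2) in
  let perf (f : R -> R[i]) : R -> R[i] :=
    Per (fun x => f x * conjc (phihat x) * phihat' x : R[i]^o) in
  let scale_invariant (f : R -> R[i]) :=
    {ae mu, forall x, f (N%:R * x) = f x} in
  let solution (h0 : R -> R[i]) :=
    [/\ L1T h0,
        {ae mu, forall w, ruelle N m0 m0' h0 w = h0 w} &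
        exists2 c : R, 0 < c &
          {ae mu, forall w, normc (h0 w) ^+ 2 <= c * h w * h' w}] in
  (forall h0 : R -> R[i], solution h0 ->
     exists f : R -> R[i],
       [/\ LpR +oo%E f, scale_invariant f &
           {ae mu, forall w, h0 w = perf f w}]) /\
  (forall f : R -> R[i], LpR +oo%E f -> scale_invariant f ->
     solution (perf f)).
Proof.
move=> mu h h' perf scale_invariant solution.
have N0 : (0 < N)%N by lia.
have [perm mm] : periodic2pi m0 /\ cmeasurable m0 by case: hm0 => ? [].
have [perm' mm'] : periodic2pi m0' /\ cmeasurable m0' by case: hm0' => ? [].
have p2 : LpR 2%:E phihat by case: Fphi.
have p2' : LpR 2%:E phihat' by case: Fphi'.
(* The function whose product with [m] is the transform of the dilation of [psi]
   is only some representative of the transform of [psi]. *)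
have rel (m p psi : R -> R[i]) : is_pi m psi (dilation N psi) -> is_fourier psi p ->
    {ae mu, forall y, real_complex R (Num.sqrt N%:R) * p (N%:R * y) = m y * p y}.
  move=> [g Fg FUg] Fp; have gp := is_fourier_unique Fp Fg.
  have := fourier_dilation N0 Fp FUg.
  by apply: filterS2 gp => y -> ->.
have relp := rel _ _ _ Uphi Fphi; have relp' := rel _ _ _ Uphi' Fphi'.
have perfE (f : R -> R[i]) :
    perf f = cPer (fun x => f x * conj_product phihat phihat' x).
  rewrite /perf; congr (cPer _); apply/funext => x.
  by rewrite /conj_product mulrA.
split=> [h0 [L1h0 ruelle_h0 [c c0 bound_h0]] | f fLpR finv].
  have nzm := nonsingular_ae perm mm nsm0.
  have nzm' := nonsingular_ae perm' mm' nsm0'.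
  exists (quotient_symbol N m0 m0' phihat phihat' h0); split.
  - exact: (quotient_symbol_LpRy hN perm perm' mm mm' p2 p2' relp relp' L1h0 c0).
  - exact: (quotient_symbol_invariant hN perm perm' p2 p2' relp relp' L1h0 c0).
  - rewrite perfE.
    exact: (solution_quotient_symbol hN perm perm' p2 p2' relp relp' L1h0 c0).
rewrite perfE; split.
- exact: (cPer_symbol_L1T p2 p2' fLpR).
- exact: (ruelle_cPer_symbol hN perm perm' p2 p2' relp relp' fLpR finv).
- exact: (cPer_symbol_bound hN p2 p2' fLpR).
Qed.
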